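(* Let $q\in\mathbb{N}$, $\lambda>0$, $0<\theta<1$ and $a_1=a_2=\dots=a_q=a>0$, and let $g(\bar x,t)$ be the probability density function of the multivariate gamma subordinator $\bar G(t)$ with these parameters (see the context). Then $g$ satisfies the differential equation $$\Big(\sum_{m=1}^{q}a^{q-m}\sum_{1\le j_1<j_2<\dots<j_m\le q}\frac{\partial^m}{\partial x_{j_1}\partial x_{j_2}\cdots\partial x_{j_m}}\Big)g(\bar{x},t)=-(1-\theta)a^q\Big(1-e^{-\frac{1}{\lambda}\partial_t}\Big)g(\bar{x},t),\qquad \bar{x}\in(0,\infty)^q,\ t\ge 0,$$ with initial condition $g(\bar{x},0)=\delta (\bar{x})$ and boundary condition $\lim_{\|\bar{x}\|\to \infty}g(\bar{x},t)=0$, where $\delta$ is the Dirac delta at the origin of $\mathbb{R}^q$, $\|\cdot\|$ is the Euclidean norm and $e^{-\frac1\lambda\partial_t}$ is the shift operator in $t$ defined in the context.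
   Context: For $i=1,\dots,q$, $\{Z_i(t)\}_{t\ge0}$ is a gamma Lévy process: $Z_i(0)=0$ and for $t>0$ the variable $Z_i(t)$ has the gamma distribution with shape $\lambda t$ and rate $a_i$, i.e. density $\frac{a_i^{\lambda t}}{\Gamma(\lambda t)}x^{\lambda t-1}e^{-a_ix}$, $x>0$. $\{B^-(\lambda t)\}_{t\ge0}$ is a negative binomial Lévy process with parameter $\theta$: $\Pr\{B^-(\lambda t)=n\}=(1-\theta)^{\lambda t}\binom{n+\lambda t-1}{n}\theta^n$, $n\in\{0,1,2,\dots\}$. The processes $Z_1,\dots,Z_q,B^-$ are mutually independent. The multivariate gamma subordinator is $\bar G(t)=(G_1(t),\dots,G_q(t))$ with $G_i(t)=Z_i\big(t+\lambda^{-1}B^-(\lambda t)\big)$, $t\ge0$. The density of $\bar G(t)$ is $$g(\bar{x},t)= \frac{(1-\theta)^{\lambda t}}{\Gamma(\lambda t)}\sum_{n=0}^{\infty}\frac{\theta^n}{n!\,(\Gamma(n+\lambda t))^{q-1}}\prod_{i=1}^{q}\frac{(a_ix_i)^{n+\lambda t}}{x_i}e^{-a_ix_i},\qquad \bar x\in(0,\infty)^q.$$ For fixed $\bar x$ this expression (with $1/\Gamma$ read as an entire function) is an analytic function of $t\in\mathbb{R}$, and the shift operator is applied to it. The condition $g(\bar x,0)=\delta(\bar x)$ means that the law of $\bar G(0)$ is the unit mass at the origin. For $k\in\mathbb{R}$ and an analytic function $f:\mathbb{R}\to\mathbb{R}$, the shift operator is $e^{-k\partial_t}f(t)=\sum_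{n=0}^{\infty}\frac{(-k\partial_t)^n}{n!}f(t)=f(t-k)$.
   Formalization: The boundary condition, which is false on (0,∞)^q for q≥2 and 0<λt<1 because g blows up near the coordinate hyperplanes, is stated as ‖x‖→∞ within [ε,∞)^q for every ε>0, and on all of (0,∞)^q when t=0 or λt≥1. *)

(* Defs.v *)
From HB Require Import structures.
From mathcomp Require Import all_boot all_order all_algebra.
From mathcomp Require Import all_classical all_reals all_analysis.

Set Implicit Arguments.
Unset Strict Implicit.
Unset Printing Implicit Defensive.

Import Order.TTheory GRing.Theory Num.Theory.
Import numFieldNormedType.Exports.

Local Open Scope classical_set_scope.
Local Open Scope ring_scope.

Section special_functions.
Context {R : realType}.

Definition Gamma (s : R) : R :=
  \int[@lebesgue_measure R]_(x in `]0, +oo[) (x `^ (s - 1) * expR (- x)).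

(* 1 / Gamma on the whole line. The number N is the least natural number with
   s + N > 0, so that N = 0 when s > 0; for s <= 0 the value is the analytic
   continuation given by 1 / Gamma(s) = s (s+1) ... (s+N-1) / Gamma(s+N). *)
Definition rGamma (s : R) : R :=
  let N := Num.truncn (1 - s) in
  (\prod_(i < N) (s + i%:R)) / Gamma (s + N%:R).

Definition gbinom (c : R) (n : nat) : R :=
  (\prod_(i < n) (c - i%:R)) / n`!%:R.

End special_functions.

Section operators.
Context {R : realType}.

(* d^m f / dx_{j_1} ... dx_{j_m} for js = [:: j_1; ...; j_m] *)
Definition mixed_partial q (js : seq 'I_q) (f : 'rV[R]_q -> R) :
    'rV[R]_q -> R :=
  foldr (fun j (h : 'rV[R]_q -> R) x => 'D_(delta_mx ord0 j) h x) f js.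

(* 'D_v is a total operator: this says that each of the successive partial
   derivatives in mixed_partial js f exists at every point of D. *)
Fixpoint mixed_partial_exists q (D : set 'rV[R]_q) (js : seq 'I_q)
    (f : 'rV[R]_q -> R) : Prop :=
  if js is j :: js' then
    mixed_partial_exists D js' f /\
    forall x, D x -> derivable (mixed_partial js' f) x (delta_mx ord0 j)
  else True.

(* sum_{m=1}^q a^{q-m} sum_{j_1 < ... < j_m} d^m / dx_{j_1} ... dx_{j_m};
   the increasing m-tuples of indices are the enumerations of the subsets of
   cardinality m. *)
Definition gamma_operator q (a : R) (f : 'rV[R]_q -> R) (x : 'rV[R]_q) : R :=
  \sum_(1 <= m < q.+1)
    a ^+ (q - m) * \sum_(J : {set 'I_q} | #|J| == m) mixed_partial (enum J) f x.

Definition shift_series (k : R) (f : R -> R) (t : R) : R ^nat :=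
  series (fun n => (- k) ^+ n / n`!%:R * derive1n n f t).

(* e^{-k d/dt} f (t), as an exponential series *)
Definition shift_operator (k : R) (f : R -> R) (t : R) : R :=
  limn (shift_series k f t).

(* shift_operator is a total limit: this says that f is smooth and that its
   Taylor series at t converges at t - k, to the expected value. *)
Definition shift_well_defined (k : R) (f : R -> R) (t : R) : Prop :=
  (forall n u, derivable (derive1n n f) u 1) /\
  shift_series k f t @ \oo --> f (t - k).

Definition euclidean_norm q (x : 'rV[R]_q) : R :=
  Num.sqrt (\sum_(i < q) x ord0 i ^+ 2).

Definition vanishes_at_infinity q (D : set 'rV[R]_q) (f : 'rV[R]_q -> R) :
    Prop :=
  forall e : R, 0 < e ->
    exists M : R, forall x, D x -> M < euclidean_norm x -> `|f x| < e.

Definition orthant q : set 'rV[R]_q := [set x | forall i, 0 < x ord0 i].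

Definition inner_orthant q (e : R) : set 'rV[R]_q :=
  [set x | forall i, e <= x ord0 i].

End operators.

Arguments orthant {R} q _.
Arguments inner_orthant {R} q e _.

Section laws.
Context d (T : measurableType d) (R : realType) (P : probability T R).

Definition mutually_independent (I : finType) (F : I -> set (set T)) : Prop :=
  forall E : I -> set T, (forall i, F i (E i)) ->
    P (\bigcap_(i in [set: I]) E i) = (\prod_(i : I) P (E i))%E.

Definition sigma_rv d' (U : measurableType d') (X : T -> U) : set (set T) :=
  preimage_set_system [set: T] X measurable.

Definition sigma_process d' (U : measurableType d') (X : R -> T -> U) :
    set (set T) :=
  <<s \bigcup_(t in [set t : R | 0 <= t]) sigma_rv (X t) >>.

(* Processes have time set [0, +oo[: the values at negative times are
   irrelevant. *)
Record levy_process (X : R -> T -> R) : Prop := {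
  levy_measurable : forall t, 0 <= t -> measurable_fun [set: T] (X t) ;
  levy_start : {ae P, forall w, X 0 w = 0} ;
  levy_independent : forall (n : nat) (t : nat -> R),
    0 <= t 0%N -> (forall j, t j <= t j.+1) ->
    mutually_independent
      (fun j : 'I_n => sigma_rv (fun w => X (t j.+1) w - X (t j) w)) ;
  levy_stationary : forall s h : R, 0 <= s -> 0 <= h ->
    forall A : set R, measurable A ->
      P [set w | A (X (s + h) w - X s w)] = P [set w | A (X h w)] ;
  levy_continuous : forall s e : R, 0 <= s -> 0 < e ->
    P [set w | e < `|X u w - X s w|]
      @[u --> within [set u : R | 0 <= u] (nbhs s)] --> 0%E }.

Record gamma_levy_process (lambda a : R) (X : R -> T -> R) : Prop := {
  gamma_levy : levy_process X ;
  gamma_law : forall t, 0 < t -> forall A : set R, measurable A ->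
    P [set w | A (X t w)] =
    (\int[@lebesgue_measure R]_(x in A `&` `]0%R, +oo[)
      (a `^ (lambda * t) / Gamma (lambda * t)
       * x `^ (lambda * t - 1) * expR (- (a * x)))%:E)%E }.

(* The process is t |-> B (lambda * t). *)
Record negbinom_levy_process (lambda theta : R) (B : R -> T -> nat) : Prop := {
  negbinom_measurable : forall t, 0 <= t ->
    measurable_fun [set: T] (B (lambda * t)) ;
  negbinom_levy : levy_process (fun t w => (B (lambda * t) w)%:R) ;
  negbinom_law : forall t, 0 <= t -> forall n : nat,
    P [set w | B (lambda * t) w = n] =
    ((1 - theta) `^ (lambda * t) * gbinom (n%:R + lambda * t - 1) n
     * theta ^+ n)%:E }.

Definition independent_processes q (lambda : R) (Z : 'I_q -> R -> T -> R)
    (B : R -> T -> nat) : Prop :=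
  mutually_independent (fun o : option 'I_q =>
    if o is Some i then sigma_process (Z i)
    else sigma_process (fun t => B (lambda * t))).

Definition gamma_subordinator q (lambda : R) (Z : 'I_q -> R -> T -> R)
    (B : R -> T -> nat) (t : R) (w : T) : q.-tuple R :=
  [tuple Z i (t + lambda^-1 * (B (lambda * t) w)%:R) w | i < q].

End laws.

Section densities.
Context {R : realType}.

(* Integral over R^n for n-dimensional Lebesgue measure of a nonnegative
   measurable function, as an iterated integral. *)
Fixpoint tuple_integral (n : nat) : (n.-tuple R -> \bar R) -> \bar R :=
  match n with
  | 0 => fun f => f [tuple]
  | n'.+1 => fun f =>
      (\int[@lebesgue_measure R]_x tuple_integral (fun v => f [tuple of x :: v]))%E
  end.

(* The law of X is carried by the open orthant, with density f there. *)
Definition has_orthant_density d (T : measurableType d) (P : probability T R)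
    q (X : T -> q.-tuple R) (f : 'rV[R]_q -> R) : Prop :=
  forall A : set (q.-tuple R), measurable A ->
    P (X @^-1` A) =
    tuple_integral (fun v =>
      (f (\row_i tnth v i)
       * \1_(A `&` [set v | forall i, 0 < tnth v i]) v)%:E).

(* Density for t > 0; rGamma extends the formula to every real t, which is what
   the shift operator in t acts on. The index set of a is 'I_q with q > 0, so
   that q - 1 is the true predecessor. *)
Definition gamma_subordinator_density q (lambda theta : R) (a : 'I_q -> R)
    (x : 'rV[R]_q) (t : R) : R :=
  (1 - theta) `^ (lambda * t) * rGamma (lambda * t) *
  limn (series (fun n =>
    theta ^+ n / n`!%:R * rGamma (n%:R + lambda * t) ^+ (q - 1) *
    \prod_(i < q) ((a i * x ord0 i) `^ (n%:R + lambda * t) / x ord0 i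
                   * expR (- (a i * x ord0 i))))).

End densities.

(* Main.v *)
Require Import Defs.
From HB Require Import structures.
From mathcomp Require Import all_boot all_order all_algebra.
From mathcomp Require Import all_classical all_reals all_analysis.
From mathcomp Require Import measurable_realfun.
From mathcomp Require Import zify ring lra.

(* Put s = lambda t. The n-th term of the series for g is a constant times
   prod_i (a x_i)^(n+s) exp(-a x_i) / x_i, and a + d/dx_i multiplies it by
   (n+s-1)/x_i. As prod_i (a + d/dx_i) is the operator of the equation plus a^q,
   one gets a series in which (n+s-1)^(q-1) is absorbed by the powers of
   1/Gamma(n+s), by the functional equation, and the remaining factor n+s-1 is
   split as (s-1) + n: the part s-1 gives (1-theta) a^q g(x, t-1/lambda) and the
   part n, after n -> n+1, gives theta a^q g(x, t).
   For the shift operator, g(x, .) is shown to be a power series with infinite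
   radius of convergence. This comes down to 1/Gamma(n + z), which Euler's product
   exhibits as a convergent product of power series f, in the norms
   sum_k |f_k| r^k, with a bound A B^n.
   The density is obtained by conditioning on B^-(lambda t) = n, and the decay at
   infinity from y^n / n! <= exp(y), applied to each y = b a x_i with b < 1. *)

Set Implicit Arguments.
Unset Strict Implicit.
Unset Printing Implicit Defensive.

Import Order.TTheory GRing.Theory Num.Theory.
Import numFieldNormedType.Exports.

Local Open Scope classical_set_scope.
Local Open Scope ring_scope.

(** * Euler's integral *)

(** Two obstacles shape the proof. The equation is asserted from [t = 0] on, so the shift evaluates
    [g] at the possibly nonpositive time [t - 1/lambda], and the exponential series must converge at
    the distance [1/lambda] from [t], however large: local analyticity is not enough. Without
    complex analysis, bounds on the values of a real function do not control its Taylor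
    coefficients. Hence the norms on coefficients, under which products, translations and summable
    series remain controlled. Only exponential growth in [n] is asked of [1/Gamma(n + z)], because
    the factor [1/n!] of the series absorbs it. The other obstacle is the boundary condition. For
    [q >= 2] and [0 < lambda t < 1], the term [n = 0] contains the negative powers
    [x_i ^ (lambda t - 1)], so that [g] is unbounded near the faces of the orthant, arbitrarily far
    from the origin. Decay is therefore obtained on the whole orthant for [t = 0] or
    [lambda t >= 1], and in general on each region where all coordinates stay above some [e > 0]. *)

Section eulerian_integral.
Context {R : realType}.
Implicit Types (s x y z : R).
Notation mu := (@lebesgue_measure R).

(** Identities are first proved in the extended reals: [Gamma] is a real-valued integral, equal to 0
    by default where the integral is infinite, so it says nothing before finiteness is known. *)
Definition eGamma s : \bar R :=
  (\int[mu]_(x in `]0%R, +oo[) (x `^ (s - 1) * expR (- x))%:E)%E.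

Lemma measurable_Gamma_integrand s (D : set R) :
  measurable_fun D (fun x : R => (x `^ (s - 1) * expR (- x))%:E).
Proof.
apply/measurable_EFinP; apply: measurable_funTS.
apply: measurable_funM; first exact: measurable_powR.
apply: measurableT_comp => //.
Qed.

Lemma Gamma_integrand_ge0 s x : 0 <= x `^ (s - 1) * expR (- x).
Proof. by rewrite mulr_ge0 ?powR_ge0 ?expR_ge0. Qed.

Lemma eGamma_ge0 s : (0 <= eGamma s)%E.
Proof. by apply: integral_ge0 => x _; rewrite lee_fin Gamma_integrand_ge0. Qed.

(** Integration by parts takes place on compact segments avoiding the singularity at 0. The offsets
    make the first segment [[1, 2]], already nondegenerate. *)
Definition posbox (n : nat) : set R := `[n.+1%:R^-1, n.+2%:R].

Lemma nondecreasing_posbox : nondecreasing_seq posbox.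
Proof.
move=> m n mn; apply/subsetPset => x; rewrite /posbox /= !in_itv /= => /andP[h1 h2].
apply/andP; split.
  apply: le_trans h1; rewrite lef_pV2 ?posrE ?ltr0n//.
  by rewrite ler_nat ltnS.
by apply: le_trans h2 _; rewrite ler_nat !ltnS.
Qed.

Lemma bigcup_posbox : \bigcup_n posbox n = `]0, +oo[%classic.
Proof.
apply/seteqP; split => [x [n _]|x].
  rewrite /posbox /= !in_itv /= andbT => /andP[h1 _].
  by apply: lt_le_trans h1; rewrite invr_gt0 ltr0n.
rewrite /= in_itv /= andbT => x0.
pose n := maxn (Num.truncn x) (Num.truncn x^-1).
exists n => //; rewrite /posbox /= in_itv /=; apply/andP; split.
  rewrite invf_ple ?posrE ?ltr0n//.
  apply: (le_trans (ltW (truncnS_gt _))).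
  by rewrite ler_nat ltnS leq_maxr.
apply: (le_trans (ltW (truncnS_gt _))).
by rewrite ler_nat ltnS; apply: leq_trans (leqnSn _); exact: leq_maxl.
Qed.

Lemma cvg_posbox_eGamma s :
  (\int[mu]_(x in posbox n) (x `^ (s - 1) * expR (- x))%:E)%E @[n --> \oo]
  --> eGamma s.
Proof.
rewrite /eGamma -bigcup_posbox.
apply: ge0_nondecreasing_set_cvg_integral.
- exact: nondecreasing_posbox.
- by move=> i; exact: measurable_itv.
- by move=> i; exact: measurable_Gamma_integrand.
- by move=> i x _; rewrite lee_fin Gamma_integrand_ge0.
Qed.

(** With an integer [n > s], [x ^ s <= x ^ n] for [x >= 1], and the term of degree [n.+1] of the
    exponential series leaves a spare factor [x]. *)
Lemma powR_expRN_le s : exists C : R,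
  0 <= C /\ forall x, 1 <= x -> x `^ s * expR (- x) <= C / x.
Proof.
pose n := (Num.truncn s).+1.
exists (n.+1)`!%:R; split => [|x x1]; first by rewrite ler0n.
have x0 : 0 < x by apply: lt_le_trans x1.
have h : x `^ s <= x ^+ n.
  rewrite -powR_mulrn ?(ltW x0)//; apply: ler_powR => //.
  exact/ltW/truncnS_gt.
rewrite expRN ler_pdivrMr ?expR_gt0// mulrAC ler_pdivlMr//.
apply: (@le_trans _ _ (x ^+ n.+1)); first by rewrite exprSr ler_pM2r.
rewrite mulrC -ler_pdivrMr ?ltr0n ?fact_gt0//.
apply: le_trans (expR_ge1Dxn n (ltW x0)).
by rewrite lerDr.
Qed.

Lemma cvg_powR_expRN s : n.+2%:R `^ s * expR (- n.+2%:R) @[n --> \oo] --> (0 : R).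
Proof.
have [C [C0 hC]] := powR_expRN_le s.
apply: (@squeeze_cvgr _ _ _ _ (cst 0) (fun n => C * n.+2%:R^-1)).
- near=> n; apply/andP; split; first by rewrite mulr_ge0 ?powR_ge0 ?expR_ge0.
  by apply: hC; rewrite ler1n.
- exact: cvg_cst.
- rewrite -(mulr0 C); apply: cvgM; first exact: cvg_cst.
  have := @cvg_harmonic R; rewrite -cvg_shiftS; exact.
Unshelve. all: by end_near. Qed.

Lemma cvg_powR_invn s : 0 < s ->
  n.+1%:R^-1 `^ s * expR (- n.+1%:R^-1) @[n --> \oo] --> (0 : R).
Proof.
move=> s0.
apply: (@squeeze_cvgr _ _ _ _ (cst 0) (fun n => n.+1%:R^-1 `^ s)).
- near=> n; apply/andP; split; first by rewrite mulr_ge0 ?powR_ge0 ?expR_ge0.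
  by rewrite ler_piMr ?powR_ge0// expR_le1 oppr_le0 invr_ge0.
- exact: cvg_cst.
- have := powR_cvg0 s0 => /(@cvg_at_rightP _ _ _) h.
  apply: h; split => [n|]; first by rewrite invr_gt0.
  exact: cvg_harmonic.
Unshelve. all: by end_near. Qed.

Lemma is_derive_expRN x : is_derive x 1 (fun y => expR (- y)) (- expR (- x)).
Proof.
have : is_derive x 1 (fun y : R => expR (- y)) ((-1) * expR (- x)).
  by apply: trigger_derive; rewrite /= mulrC.
by rewrite mulN1r.
Qed.

Lemma is_derive_powRl s x : 0 < x ->
  is_derive x 1 (fun y => y `^ s) (s * x `^ (s - 1)).
Proof.
move=> x0; have xin : x \in `]0, +oo[ by rewrite in_itv /= x0.
split; first exact: derivable_powR.
by rewrite -derive1E powR_derive1.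
Qed.

(** The functional equation on a segment, with boundary terms that vanish in the limit. The exponent
    stays [s + 1 - 1] to match the integrand of [eGamma (s + 1)]. *)
Lemma posbox_by_parts s n : 0 < s ->
  (\int[mu]_(x in posbox n) (x `^ (s + 1 - 1) * expR (- x))%:E =
   (n.+1%:R^-1 `^ s * expR (- n.+1%:R^-1) - n.+2%:R `^ s * expR (- n.+2%:R))%:E
   + s%:E * \int[mu]_(x in posbox n) (x `^ (s - 1) * expR (- x))%:E)%E.
Proof.
move=> s0.
have a0 : 0 < n.+1%:R^-1 :> R by rewrite invr_gt0.
have ab : n.+1%:R^-1 < n.+2%:R :> R.
  apply: (@le_lt_trans _ _ 1); last by rewrite ltr1n.
  by rewrite invf_le1 ?ler1n.
have pos x : x \in posbox n -> 0 < x.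
  by rewrite inE /posbox /= in_itv /= => /andP[+ _]; exact: lt_le_trans.
have cE x : {for x, continuous (fun y : R => expR (- y))}.
  by apply: differentiable_continuous; apply/derivable1_diffP; case: (is_derive_expRN x).
have cp r x : 0 < x -> {for x, continuous (fun y : R => y `^ r)}.
  move=> x0; apply: differentiable_continuous; apply/derivable1_diffP.
  by case: (is_derive_powRl r x0).
have cint : {within posbox n, continuous (fun x => x `^ (s - 1) * expR (- x))}.
  apply: derivable_within_continuous => x; rewrite in_itv /= => /andP[+ _].
  move=> /(lt_le_trans a0) x0.
  apply: derivableM; first by case: (is_derive_powRl (s - 1) x0).
  by case: (is_derive_expRN x).
rewrite (addrK 1 s).
rewrite (@integration_by_parts R (fun x => x `^ s) (fun x => - expR (- x))
  (fun x => s * x `^ (s - 1)) (fun x => expR (- x)))//.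
- rewrite !mulrN opprK (addrC (- _)); congr (_ + _)%E.
  under eq_integral do rewrite mulrN -mulrA -mulNr EFinM.
  rewrite integralZl//.
    by rewrite EFinN mulNe oppeK.
  by apply: continuous_compact_integrable => //; exact: segment_compact.
- apply: derivable_within_continuous => x; rewrite in_itv /= => /andP[+ _].
  move=> /(lt_le_trans a0) x0.
  by apply: derivableM => //; case: (is_derive_powRl (s - 1) x0).
- split.
  + by move=> x; rewrite in_itv /= => /andP[/(lt_trans a0) x0 _]; case: (is_derive_powRl s x0).
  + by apply: cvg_at_right_filter; exact: cp.
  + by apply: cvg_at_left_filter; apply: cp; exact: lt_trans ab.
- move=> x; rewrite in_itv /= => /andP[/(lt_trans a0) x0 _].
  by rewrite derive1E; case: (is_derive_powRl s x0).
- by apply: continuous_subspaceT => x; exact: cE.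
- split.
  + by move=> x _; apply: derivableN; case: (is_derive_expRN x).
  + by apply: cvg_at_right_filter; apply: cvgN; exact: cE.
  + by apply: cvg_at_left_filter; apply: cvgN; exact: cE.
- move=> x _; rewrite derive1E deriveN; case: (is_derive_expRN x) => // _ ->.
  by rewrite opprK.
Qed.

Lemma eGammaD1 s : 0 < s -> eGamma (s + 1) = (s%:E * eGamma s)%E.
Proof.
move=> s0; rewrite -(cvg_lim _ (@cvg_posbox_eGamma (s + 1)))//; apply/cvg_lim => //.
rewrite (funext (fun n => posbox_by_parts n s0)) -[X in _ --> X]add0e; apply: cvgeD => //.
- apply: cvg_EFin; first exact: nearW.
  rewrite -[X in _ --> X](subr0 0); apply: cvgB.
    exact: cvg_powR_invn.
  exact: cvg_powR_expRN.
- by apply: cvgeZl => //; exact: cvg_posbox_eGamma.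
Qed.

End eulerian_integral.

(** * The Gamma function, its reciprocal on the whole line, and Euler's product *)

Section gamma_function.
Context {R : realType}.
Implicit Types (s x y z : R).
Notation mu := (@lebesgue_measure R).

Lemma eGamma1_lty : (eGamma (1 : R) < +oo)%E.
Proof.
apply: (@le_lt_trans _ _ (\int[mu]_(x in `[0%R, +oo[) (expR (- x))%:E)%E).
  rewrite /eGamma; under eq_integral do rewrite subrr powRr0 mul1r.
  apply: ge0_subset_integral => //.
  - apply/measurable_EFinP; apply: measurable_funTS.
    exact: measurableT_comp.
  - by move=> x; rewrite /= !in_itv /= !andbT => /ltW.
rewrite (@ge0_continuous_FTC2y _ _ (fun x => - expR (- x)) 0 0)//.
- by rewrite ltry.
- apply: continuous_subspaceT => x; apply: differentiable_continuous.
  by apply/derivable1_diffP; case: (is_derive_expRN x).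
- by rewrite -oppr0; apply: cvgN; exact: cvgr_expR.
- apply: cvg_at_right_filter; apply: cvgN.
  have cE : {for 0, continuous (fun y : R => expR (- y))}.
    apply: differentiable_continuous.
    by apply/derivable1_diffP; case: (is_derive_expRN (0 : R)).
  exact: cE.
- move=> x _; rewrite derive1E deriveN; case: (is_derive_expRN x) => // _ ->.
  by rewrite opprK.
Qed.

Lemma eGamma_nat_lty n : (eGamma (n.+1%:R : R) < +oo)%E.
Proof.
elim: n => [|n ih]; first exact: eGamma1_lty.
by rewrite -natr1 eGammaD1 ?ltr0n// lte_mul_pinfty// lee_fin ler0n.
Qed.

(** For [r >= 1] the integrand is dominated by those of 1 and of an integer above [r]. A small [s]
    is reached through the functional equation: an infinite value at [s] would be infinite at
    [s + 1]. *)
Lemma eGamma_lty s : 0 < s -> (eGamma s < +oo)%E.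
Proof.
have ge1 (r : R) : 1 <= r -> (eGamma r < +oo)%E.
  move=> r1; pose n := Num.truncn r.
  apply: (@le_lt_trans _ _ (eGamma 1 + eGamma n.+1%:R)%E); last first.
    by rewrite lte_add_pinfty// ?eGamma1_lty ?eGamma_nat_lty.
  rewrite /eGamma -ge0_integralD//; last 4 first.
  - by move=> x _; rewrite lee_fin Gamma_integrand_ge0.
  - exact: measurable_Gamma_integrand.
  - by move=> x _; rewrite lee_fin Gamma_integrand_ge0.
  - exact: measurable_Gamma_integrand.
  apply: ge0_le_integral => //.
  - by move=> x _; rewrite lee_fin Gamma_integrand_ge0.
  - exact: measurable_Gamma_integrand.
  - by apply: emeasurable_funD; exact: measurable_Gamma_integrand.
  - move=> x; rewrite /= in_itv /= andbT => x0.
    rewrite -EFinD lee_fin -mulrDl ler_pM2r ?expR_gt0// subrr powRr0.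
    have [x1|x1] := leP x 1.
      rewrite (@le_trans _ _ 1)//; last by rewrite lerDl powR_ge0.
      by rewrite -[leRHS](powRr0 x) ger_powR ?x0// subr_ge0.
    apply: (@le_trans _ _ (x `^ (n.+1%:R - 1))); last by rewrite lerDr.
    apply: ler_powR; first exact: ltW.
    by rewrite lerD2r; exact/ltW/truncnS_gt.
move=> s0; have : (eGamma (s + 1) < +oo)%E by apply: ge1; rewrite lerDr ltW.
rewrite eGammaD1//; have := eGamma_ge0 s.
by case: (eGamma s) => // [r|] _ //; rewrite ?ltry// gt0_muley// lte_fin.
Qed.

(** At [s + 1] the power is at least 1 on [[1, 2]], which gives a positive lower bound; the
    functional equation brings positivity back to [s]. *)
Lemma eGamma_gt0 s : 0 < s -> (0 < eGamma s)%E.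
Proof.
move=> s0; have : (0 < eGamma (s + 1))%E; last first.
  rewrite eGammaD1//; have := eGamma_ge0 s; rewrite le_eqVlt => /predU1P[<-|//].
  by rewrite mule0 ltxx.
apply: (@lt_le_trans _ _ (\int[mu]_(x in `[1%R, 2%R]) (expR (- 2))%:E)%E).
  rewrite integral_cst//= lebesgue_measure_itv /= lte_fin ltr1n -EFinD -EFinM lte_fin.
  by rewrite mulr_gt0 ?expR_gt0// subr_gt0 ltr1n.
apply: (@le_trans _ _
    (\int[mu]_(x in `[1%R, 2%R]) (x `^ (s + 1 - 1) * expR (- x))%:E)%E).
  apply: ge0_le_integral => //.
  - exact: measurable_Gamma_integrand.
  - move=> x; rewrite /= in_itv /= => /andP[x1 x2]; rewrite lee_fin.
    rewrite -[leLHS]mul1r ler_pM ?expR_ge0 ?ler_expR ?lerN2//.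
    by rewrite -(powRr0 x) ler_powR// addrK ltW.
apply: ge0_subset_integral => //.
- exact: measurable_Gamma_integrand.
- by move=> x _; rewrite lee_fin Gamma_integrand_ge0.
- by move=> x; rewrite /= !in_itv /= andbT => /andP[+ _]; exact: lt_le_trans.
Qed.

Lemma eGammaE s : 0 < s -> eGamma s = (Gamma s)%:E.
Proof.
by move=> s0; rewrite /Gamma /Rintegral -/(eGamma s) fineK// ge0_fin_numE
  ?eGamma_ge0 ?eGamma_lty.
Qed.

Lemma Gamma_gt0 s : 0 < s -> 0 < Gamma s.
Proof. by move=> s0; rewrite -lte_fin -eGammaE ?eGamma_gt0. Qed.

Lemma GammaD1 s : 0 < s -> Gamma (s + 1) = s * Gamma s.
Proof.
move=> s0; apply: EFin_inj; rewrite EFinM -!eGammaE ?eGammaD1//.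
by rewrite addr_gt0.
Qed.

Lemma rGammaV s : 0 < s -> rGamma s = (Gamma s)^-1.
Proof.
move=> s0; rewrite /rGamma.
have -> : Num.truncn (1 - s) = 0%N.
  by apply/truncn0Pn; rewrite -ltNge gtrBl.
by rewrite big_ord0 mul1r addr0.
Qed.

Lemma rGamma_gt0 s : 0 < s -> 0 < rGamma s.
Proof. by move=> s0; rewrite rGammaV// invr_gt0 Gamma_gt0. Qed.

(** For [z <= 0], passing to [z + 1] removes exactly the first factor of the product and leaves the
    argument of [Gamma] unchanged. There is no exceptional point: the zeros at the nonpositive
    integers are included. *)
Lemma rGammaD1 z : rGamma z = z * rGamma (z + 1).
Proof.
have [z0|z0] := leP z 0; last first.
  have z10 : 0 < z + 1 by rewrite addr_gt0.
  rewrite !rGammaV// GammaD1// invfM mulrA mulfV ?mul1r//.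
  by rewrite gt_eqF.
have nz0 : 0 <= - z by rewrite oppr_ge0.
rewrite /rGamma.
have -> : Num.truncn (1 - z) = (Num.truncn (1 - (z + 1))).+1.
  have -> : 1 - (z + 1) = - z by ring.
  apply: truncn_def.
  have /andP[h1 h2] := truncn_itv nz0.
  by rewrite -natr1 (addrC _ 1) lerD2l h1 /= -natr1 (addrC _ 1) ltrD2l.
rewrite big_ord_recl /= addr0 -mulrA; congr (_ * _); congr (_ / _).
  by apply: eq_bigr => i _; rewrite /bump /= add1n -natr1 addrAC addrA.
by rewrite -natr1 (addrC _ 1) addrA.
Qed.

Lemma rGamma0 : rGamma (0 : R) = 0.
Proof. by rewrite rGammaD1 mul0r. Qed.

Lemma rGamma_natD z n : rGamma z = \prod_(i < n) (z + i%:R) * rGamma (z + n%:R).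
Proof.
elim: n => [|n ih]; first by rewrite big_ord0 mul1r addr0.
by rewrite big_ord_recr /= -mulrA -natr1 addrA -rGammaD1.
Qed.

(** The tangent at 1 to the concave function [y ^ s]. With [u = ln y], the inequality
    [1 + v <= expR v] is used at [(1 - s) * u] and at [- (s * u)], with weights [s] and [1 - s], for
    which the linear terms cancel. *)
Lemma powR_le_affine s y : 0 <= s <= 1 -> 0 < y -> y `^ s <= s * y + (1 - s).
Proof.
move=> /andP[s0 s1] y0; rewrite /powR gt_eqF//.
set u := ln y; have -> : y = expR u by rewrite lnK.
have h1 : expR (s * u) * (1 + (1 - s) * u) <= expR u.
  have {3}-> : u = s * u + (1 - s) * u by ring.
  by rewrite expRD ler_pM2l ?expR_gt0// expR_ge1Dx.
have h2 : expR (s * u) * (1 - s * u) <= 1.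
  by rewrite -[leRHS](expRxMexpNx_1 (s * u)) ler_pM2l ?expR_gt0// expR_ge1Dx.
have := lerD (ler_wpM2l s0 h1) (ler_wpM2l (_ : 0 <= 1 - s) h2).
by rewrite subr_ge0 => /(_ s1); lra.
Qed.

(** The affine bound at [y = x / a] is integrated against [x ^ (a - 1) * expR (- x)]. As
    [Gamma (a + 1) / a = Gamma a], this normalisation makes the two terms add up to exactly
    [a ^ s * Gamma a]. *)
Lemma Gamma_add_le a s : 0 < a -> 0 <= s <= 1 ->
  Gamma (a + s) <= a `^ s * Gamma a.
Proof.
move=> a0 s01; have /andP[s0 s1] := s01.
have as0 : 0 < a + s by apply: ltr_wpDr.
have c0 : 0 <= a `^ s by exact: powR_ge0.
have d0 : 0 <= a `^ s * (s / a).
  by rewrite mulr_ge0// divr_ge0// ltW.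
have e0 : 0 <= a `^ s * (1 - s) by rewrite mulr_ge0 ?subr_ge0.
have key : (eGamma (a + s) <= (a `^ s * (s / a))%:E * eGamma (a + 1)
    + (a `^ s * (1 - s))%:E * eGamma a)%E.
  rewrite /eGamma -!ge0_integralZl//; first last.
  - by move=> x _; rewrite lee_fin Gamma_integrand_ge0.
  - exact: measurable_Gamma_integrand.
  - by move=> x _; rewrite lee_fin Gamma_integrand_ge0.
  - exact: measurable_Gamma_integrand.
  rewrite -ge0_integralD//; first last.
  - by apply: measurable_funeM; exact: measurable_Gamma_integrand.
  - by move=> x _; apply: mule_ge0; rewrite lee_fin//; exact: Gamma_integrand_ge0.
  - by apply: measurable_funeM; exact: measurable_Gamma_integrand.
  - by move=> x _; apply: mule_ge0; rewrite lee_fin//; exact: Gamma_integrand_ge0.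
  apply: ge0_le_integral => //.
  - by move=> x _; rewrite lee_fin Gamma_integrand_ge0.
  - exact: measurable_Gamma_integrand.
  - apply: emeasurable_funD; apply: measurable_funeM; exact: measurable_Gamma_integrand.
  - move=> x; rewrite /= in_itv /= andbT => x0.
    rewrite -!EFinM -EFinD lee_fin !mulrA -mulrDl ler_pM2r ?expR_gt0//.
    rewrite addrK.
    have xN : x != 0 by rewrite gt_eqF.
    have -> : a + s - 1 = s + (a - 1) by ring.
    have -> : x `^ a = x * x `^ (a - 1) by rewrite mulr_powRB1// ltW.
    rewrite powRD; last by rewrite xN implybT.
    rewrite mulrA -mulrDl ler_pM2r ?powR_gt0//.
    have h : a `^ s * (x / a) `^ s <= a `^ s * (s * (x / a) + (1 - s)).
      by rewrite ler_pM2l ?powR_gt0// powR_le_affine ?divr_gt0.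
    move: h; rewrite -powRM ?divr_ge0 ?(ltW a0) ?(ltW x0)//.
    rewrite mulrCA mulfV ?gt_eqF// mulr1 => /le_trans; apply.
    by rewrite le_eqVlt; apply/orP; left; apply/eqP; field; rewrite gt_eqF.
move: key; rewrite eGammaD1// !eGammaE// -!EFinM -EFinD lee_fin => /le_trans; apply.
rewrite le_eqVlt; apply/orP; left; apply/eqP; field; by rewrite gt_eqF.
Qed.

(** [N ^ z * Gamma N / Gamma (N + z)] with [N = n + 1]; that it tends to 1 is a form of Euler's
    limit for [Gamma]. *)
Definition gamma_ratio z n : R :=
  n.+1%:R `^ z * Gamma n.+1%:R * rGamma (z + n.+1%:R).

Lemma gamma_ratioD1 z n :
  gamma_ratio z n = gamma_ratio (z + 1) n * (1 + z / n.+1%:R).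
Proof.
rewrite /gamma_ratio (rGammaD1 (z + _)) powRD; last by rewrite pnatr_eq0 implybT.
rewrite powRr1 ?ler0n// (addrAC z 1).
have : n.+1%:R != 0 :> R by rewrite pnatr_eq0.
by move: (n.+1%:R : R) => N N0; field.
Qed.

(** Wendel's argument: [Gamma_add_le] from [N] to [N + s] gives the lower bound, and from [N + s] to
    [N + 1] the upper bound [(1 + s / N) ^ (1 - s)]. *)
Lemma gamma_ratio_itv s n : 0 <= s <= 1 ->
  1 <= gamma_ratio s n <= 1 + n.+1%:R^-1.
Proof.
move=> s01; have /andP[s0 s1] := s01; rewrite /gamma_ratio.
set N : R := n.+1%:R; have N0 : 0 < N by rewrite ltr0n.
have sN0 : 0 < N + s by rewrite ltr_wpDr.
have NV : N != 0 by rewrite gt_eqF.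
rewrite (addrC s) rGammaV//; have G0 := Gamma_gt0 sN0.
apply/andP; split.
  by rewrite ler_pdivlMr// mul1r Gamma_add_le.
rewrite ler_pdivrMr//.
have s01' : 0 <= 1 - s <= 1 by rewrite subr_ge0 s1 gerBl s0.
have := Gamma_add_le sN0 s01'.
rewrite -addrA subrKC GammaD1// => h.
rewrite -(@ler_pM2r _ (N `^ (1 - s))) ?powR_gt0//.
have -> : N `^ s * Gamma N * N `^ (1 - s) = N * Gamma N.
  rewrite mulrAC -powRD ?NV ?implybT// subrKC powRr1//.
apply: (le_trans h); rewrite mulrAC ler_pM2r//.
have -> : N + s = N * (1 + s / N) by field.
have q0 : 0 <= 1 + s / N by rewrite addr_ge0// divr_ge0// ltW.
rewrite powRM// mulrC ler_pM2r ?powR_gt0//.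
have /andP[_ r1] := s01'.
apply: (@le_trans _ _ (1 + s / N)).
  apply: ler1_powR => //; rewrite lerDl divr_ge0//; exact: ltW.
by rewrite lerD2l -[leRHS]mul1r ler_pM2r// invr_gt0.
Qed.

Lemma cvg_1Ddivn z : 1 + z / n.+1%:R @[n --> \oo] --> (1 : R).
Proof.
rewrite -[X in _ --> X]addr0 -[X in _ --> _ + X](mulr0 z).
apply: cvgD; first exact: cvg_cst.
by apply: cvgM; [exact: cvg_cst|exact: cvg_harmonic].
Qed.

Lemma cvg_gamma_ratio_itv s : 0 <= s <= 1 -> gamma_ratio s @ \oo --> (1 : R).
Proof.
move=> s01; apply: (@squeeze_cvgr _ _ _ _ (cst 1) (fun n => 1 + 1 / n.+1%:R)).
- by near=> n; rewrite div1r; exact: gamma_ratio_itv.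
- exact: cvg_cst.
- exact: cvg_1Ddivn.
Unshelve. all: by end_near. Qed.

Lemma cvg_gamma_ratioD1 z :
  gamma_ratio (z + 1) @ \oo --> (1 : R) <-> gamma_ratio z @ \oo --> (1 : R).
Proof.
split => h.
  rewrite (funext (gamma_ratioD1 z)) -[X in _ --> X]mulr1.
  by apply: cvgM => //; exact: cvg_1Ddivn.
rewrite -[X in _ --> X]divr1.
have h' : gamma_ratio z n / (1 + z / n.+1%:R) @[n --> \oo] --> (1 / 1 : R).
  by apply: cvgM => //; apply: cvgV; [rewrite oner_eq0|exact: cvg_1Ddivn].
apply: cvg_trans h'; apply: near_eq_cvg; near=> n.
rewrite gamma_ratioD1 mulfK// gt_eqF//.
near: n; apply: (cvgr_gt 1 (cvg_1Ddivn z)); exact: ltr01.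
Unshelve. all: by end_near. Qed.

(** A unit step in [z] changes the ratio by the factor [1 + z / (n + 1)], which tends to 1. Integer
    steps in both directions thus reduce every real [z] to its fractional part. *)
Lemma cvg_gamma_ratio z : gamma_ratio z @ \oo --> (1 : R).
Proof.
pose s := z - (Num.floor z)%:~R.
have hs : gamma_ratio s @ \oo --> (1 : R).
  apply: cvg_gamma_ratio_itv; rewrite /s subr_ge0 ge_floor /=.
  by rewrite lerBlDl ltW// -intrD1 floorD1_gt.
have -> : z = s + (Num.floor z)%:~R by rewrite subrK.
clearbody s.
case: (Num.floor z) => n.
  elim: n => [|n ih]; first by rewrite addr0.
  rewrite -pmulrn -natr1 addrA; apply/cvg_gamma_ratioD1.
  by move: ih; rewrite -pmulrn.
rewrite NegzE mulrNz -pmulrn.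
have e m : s - m.+1%:R + 1 = s - m%:R by rewrite -natr1; ring.
elim: n => [|n ih]; apply: (cvg_gamma_ratioD1 _).1; rewrite e.
  by rewrite mulr0n subr0; exact: hs.
exact: ih.
Qed.

(* [(1 + z / k) * (k / (k+1)) ^ z]: the power makes the factor [1 + O(k^-2)], and
   the product of these powers telescopes to the [N ^ -z] of Euler's limit. *)
Definition euler_factor (k : nat) z : R :=
  (1 + z / k%:R) * expR (- (z * ln (k.+1%:R / k%:R))).

(** The product telescopes by the functional equation. Starting it at [n.+1] instead of 1 reaches
    [1/Gamma(n + 1 + z)] directly, up to an explicit normalisation, so that the later bound on the
    product is uniform in [n]. *)
Lemma rGamma_euler_partial n m z :
  \prod_(i < m) euler_factor (n.+1 + i) z * gamma_ratio z (n + m) =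
  Gamma n.+1%:R * n.+1%:R `^ z * rGamma (n.+1%:R + z).
Proof.
elim: m => [|m ih].
  by rewrite big_ord0 mul1r addn0 /gamma_ratio (addrC z); ring.
rewrite big_ord_recr /= -ih -mulrA; congr (_ * _).
rewrite addnS /gamma_ratio /euler_factor addSn.
set k : R := (n + m).+1%:R; have k0 : 0 < k by rewrite ltr0n.
have k0' : 0 < (n + m).+2%:R :> R by rewrite ltr0n.
rewrite [in RHS]rGammaD1 -/k -[in RHS]addrA natr1.
have -> : Gamma (n + m).+2%:R = k * Gamma k by rewrite -natr1 GammaD1.
rewrite expRN lnM ?posrE ?invr_gt0// lnV ?posrE//.
rewrite /powR !gt_eqF// mulrBr expRB.
by field; rewrite !gt_eqF ?expR_gt0.
Qed.

Lemma rGamma_euler_product n z :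
  \prod_(i < m) euler_factor (n.+1 + i) z @[m --> \oo] -->
  Gamma n.+1%:R * n.+1%:R `^ z * rGamma (n.+1%:R + z).
Proof.
have h : gamma_ratio z (m + n) @[m --> \oo] --> (1 : R).
  by rewrite cvg_shiftn; exact: cvg_gamma_ratio.
rewrite -[X in _ --> X]divr1.
have h' : Gamma n.+1%:R * n.+1%:R `^ z * rGamma (n.+1%:R + z) /
    gamma_ratio z (m + n) @[m --> \oo] -->
   Gamma n.+1%:R * n.+1%:R `^ z * rGamma (n.+1%:R + z) / 1.
  by apply: cvgM; [exact: cvg_cst|apply: cvgV => //; rewrite oner_eq0].
apply: cvg_trans h'; apply: near_eq_cvg; near=> m.
rewrite -(rGamma_euler_partial n m) (addnC n) mulfK// gt_eqF//.
near: m; apply: (cvgr_gt 1 h); exact: ltr01.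
Unshelve. all: by end_near. Qed.

End gamma_function.

(** * Power series with infinite radius of convergence *)

Section entire.
Context {R : realType}.
Implicit Types (c d a b : R^nat) (f g N M : R -> R) (r u t l B : R).

Lemma le_series_pos a : (forall n, 0 <= a n) -> {homo series a : m n / (m <= n)%N >-> m <= n}.
Proof.
move=> a0 m n mn; rewrite /series/= (big_cat_nat (leq0n m) mn)//= lerDl.
exact: sumr_ge0.
Qed.

Lemma bounded_series_cvg a B : (forall m, series (fun n => `|a n|) m <= B) ->
  cvgn (series a).
Proof.
move=> h; apply: normed_cvg; apply: nondecreasing_is_cvgn.
  by apply: le_series_pos => n; exact: normr_ge0.
by exists B => _ [m _ <-]; exact: h.
Qed.

Lemma cvg_le_bound (v : R^nat) l B :
  v @ \oo --> l -> (forall n, v n <= B) -> l <= B.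
Proof. by move=> vl h; apply: cvgr_to_le vl _; exact: nearW. Qed.

Lemma series_tail_le a b la lb m : (forall n, `|a n| <= b n) ->
  series a @ \oo --> la -> series b @ \oo --> lb ->
  `|la - series a m| <= lb - series b m.
Proof.
move=> ab ala blb.
have h1 : `|series a p - series a m| @[p --> \oo] --> `|la - series a m|.
  by apply: cvg_norm; apply: cvgB => //; exact: cvg_cst.
have h2 : series b p - series b m @[p --> \oo] --> lb - series b m.
  by apply: cvgB => //; exact: cvg_cst.
apply: (ler_cvg_to h1 h2); near=> p.
have mp : (m <= p)%N by near: p; exact: nbhs_infty_ge.
rewrite /series /= !(big_cat_nat (leq0n m) mp)//= [X in `|X - _|]addrC addrK.
rewrite [X in _ <= X - _]addrC addrK.
by apply: le_trans (ler_norm_sum _ _ _) _; apply: ler_sum => i _.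
Unshelve. all: by end_near. Qed.

(* [N r] bounds the norm [sum_k |c_k| r^k], for which power series form a
   Banach algebra. *)
Definition psummable c N :=
  forall r K, 0 <= r -> series (fun k => `|c k| * r ^+ k) K <= N r.

Definition entire_bound f N :=
  exists2 c, psummable c N & forall u, pseries c u @ \oo --> f u.

Lemma psummable_ge0 c N r : psummable c N -> 0 <= r -> 0 <= N r.
Proof. by move=> h r0; have := h r 0%N r0; rewrite /series /= big_geq. Qed.

Lemma entire_bound_ge0 f N r : entire_bound f N -> 0 <= r -> 0 <= N r.
Proof. by case=> c h _; exact: psummable_ge0 h. Qed.

Lemma psummable_cvg c N u : psummable c N -> cvgn (pseries c u).
Proof.
move=> h; apply: (@bounded_series_cvg _ (N `|u|)) => m.
under eq_fun do rewrite normrM normrX.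
exact: h.
Qed.

Lemma pseries_norm_le c N u K : psummable c N -> `|pseries c u K| <= N `|u|.
Proof.
move=> h; apply: le_trans (h `|u| K (normr_ge0 u)).
apply: le_trans (ler_norm_sum _ _ _) _.
by apply: ler_sum => i _; rewrite normrM normrX.
Qed.

Lemma entire_bound_norm f N u : entire_bound f N -> `|f u| <= N `|u|.
Proof.
case=> c h hf; apply: (cvg_le_bound (cvg_norm (hf u))) => n.
exact: pseries_norm_le.
Qed.

Lemma entire_bound_le f N M : entire_bound f N ->
  (forall r, 0 <= r -> N r <= M r) -> entire_bound f M.
Proof.
case=> c h hf NM; exists c => // r K r0.
by apply: le_trans (h r K r0) _; exact: NM.
Qed.

Lemma entire_bound_ext f g N : entire_bound f N -> f =1 g -> entire_bound g N.
Proof. by move=> h /funext <-. Qed.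

(** Completeness of the norms. Coefficients are added degree by degree, and [M] dominates the
    resulting double sum at every radius, which justifies the exchange of the two summations. *)
Lemma entire_bound_series (f : nat -> R -> R) (N : nat -> R -> R) F M :
  (forall n, entire_bound (f n) (N n)) ->
  (forall r m, 0 <= r -> series (N ^~ r) m <= M r) ->
  (forall u, series (f ^~ u) @ \oo --> F u) -> entire_bound F M.
Proof.
move=> hf hN hF.
have /choice[c hc] : forall n, exists c, psummable c (N n) /\
    forall u, pseries c u @ \oo --> f n u.
  by move=> n; have [c] := hf n; exists c.
have cs n : psummable (c n) (N n) by have [] := hc n.
have N0 n r : 0 <= r -> 0 <= N n r by move=> r0; exact: psummable_ge0 (cs n) r0.
have cN n r k : 0 <= r -> `|c n k| * r ^+ k <= N n r.
  move=> r0; apply: le_trans (cs n r k.+1 r0).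
  by rewrite /series /= big_nat_recr//= lerDr sumr_ge0// => i _; rewrite mulr_ge0// exprn_ge0.
have cC k : cvgn (series (c ^~ k)).
  apply: (@bounded_series_cvg _ (M 1)) => m.
  apply: le_trans (hN 1 m ler01); apply: ler_sum => n _.
  by have := cN n 1 k ler01; rewrite expr1n mulr1.
pose C k := limn (series (c ^~ k)).
have exch u K m : series (fun n => pseries (c n) u K) m =
    \sum_(0 <= k < K) series (c ^~ k) m * u ^+ k.
  rewrite /pseries /series /= exchange_big_nat /=; apply: eq_bigr => k _.
  by rewrite mulr_suml.
have cK u K : series (fun n => pseries (c n) u K) @ \oo --> pseries C u K.
  rewrite (funext (exch u K)) /pseries /series /=.
  elim: K => [|K ih].
    by under eq_fun do rewrite big_geq//; rewrite big_geq//; exact: cvg_cst.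
  under eq_fun do rewrite big_nat_recr//=.
  rewrite big_nat_recr//=; apply: cvgD => //.
  by apply: cvgM; [exact: cC|exact: cvg_cst].
exists C => [r K r0|u].
  have h : \sum_(0 <= k < K) `|series (c ^~ k) m| * r ^+ k @[m --> \oo] -->
     \sum_(0 <= k < K) `|C k| * r ^+ k.
    elim: K => [|K ih].
      by under eq_fun do rewrite big_geq//; rewrite big_geq//; exact: cvg_cst.
    under eq_fun do rewrite big_nat_recr//=.
    rewrite big_nat_recr//=; apply: cvgD => //.
    by apply: cvgM; [apply: cvg_norm; exact: cC|exact: cvg_cst].
  apply: (cvg_le_bound h) => m.
  apply: le_trans (hN r m r0).
  apply: (@le_trans _ _ (\sum_(0 <= k < K) \sum_(0 <= n < m) `|c n k| * r ^+ k)).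
    apply: ler_sum => k _; rewrite -mulr_suml ler_wpM2r ?exprn_ge0//.
    exact: ler_norm_sum.
  by rewrite exchange_big_nat /=; apply: ler_sum => n _; exact: cs.
pose r := `|u|; have r0 : 0 <= r by exact: normr_ge0.
have cvN : cvgn (series (N ^~ r)).
  apply: (@bounded_series_cvg _ (M r)) => m.
  by under eq_fun do rewrite ger0_norm ?N0//; exact: hN.
pose L := limn (series (N ^~ r)).
have tail1 K m : `|pseries C u K - series (fun n => pseries (c n) u K) m| <=
    L - series (N ^~ r) m.
  by apply: series_tail_le (cK u K) cvN => n; exact: pseries_norm_le.
have tail2 m : `|F u - series (f ^~ u) m| <= L - series (N ^~ r) m.
  by apply: series_tail_le (hF u) cvN => n; exact: entire_bound_norm.
have part m : series (fun n => pseries (c n) u K) m @[K --> \oo] -->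
    series (f ^~ u) m.
  rewrite /series /=; elim: m => [|m ih].
    by under eq_fun do rewrite big_geq//; rewrite big_geq//; exact: cvg_cst.
  under eq_fun do rewrite big_nat_recr//=.
  by rewrite big_nat_recr//=; apply: cvgD => //; have [_] := hc m; exact.
(* The tail bounds [tail1] and [tail2] do not depend on the truncation degree [K]. The number [m] of
   functions is therefore fixed first, and [K] is sent to infinity for these finitely many. *)
apply/cvgrPdist_le => e e0.
have e30 : 0 < e / 3 by rewrite divr_gt0.
have [m hm] : exists m, L - series (N ^~ r) m <= e / 3.
  have /cvgrPdist_le/(_ _ e30)[m _ hm] := cvN.
  exists m; apply: le_trans (ler_norm _) _; exact: (hm m (leqnn m)).
have /cvgrPdist_le/(_ _ e30) := part m.
apply: filterS => K hK.
have -> : F u - pseries C u K = (F u - series (f ^~ u) m)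
  + (series (f ^~ u) m - series (fun n => pseries (c n) u K) m)
  - (pseries C u K - series (fun n => pseries (c n) u K) m) by ring.
have -> : e = e / 3 + e / 3 + e / 3 by field.
apply: le_trans (ler_normB _ _) _; apply: lerD.
  apply: le_trans (ler_normD _ _) _; apply: lerD => //.
  exact: le_trans (tail2 m) hm.
exact: le_trans (tail1 K m) hm.
Qed.

Lemma entire_bound_series_cvg (f : nat -> R -> R) (N : nat -> R -> R) M u :
  (forall n, entire_bound (f n) (N n)) ->
  (forall r m, 0 <= r -> series (N ^~ r) m <= M r) ->
  cvgn (series (f ^~ u)).
Proof.
move=> hf hN; apply: (@bounded_series_cvg _ (M `|u|)) => m.
apply: le_trans (hN _ m (normr_ge0 u)); apply: ler_sum => n _.
exact: entire_bound_norm.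
Qed.

Lemma entire_bound_lim (f : nat -> R -> R) (N : nat -> R -> R) M :
  (forall n, entire_bound (f n) (N n)) ->
  (forall r m, 0 <= r -> series (N ^~ r) m <= M r) ->
  entire_bound (fun u => limn (series (f ^~ u))) M.
Proof.
move=> hf hN; apply: (entire_bound_series hf hN) => u.
exact: entire_bound_series_cvg hf hN.
Qed.

Lemma entire_boundZ l f N : entire_bound f N ->
  entire_bound (fun u => l * f u) (fun r => `|l| * N r).
Proof.
case=> c h hf; exists (fun k => l * c k) => [r K r0|u].
  rewrite /series /=; under eq_bigr do rewrite normrM -mulrA.
  by rewrite -mulr_sumr ler_wpM2l//; exact: h.
have -> : pseries (fun k => l * c k) u = (fun K => l * pseries c u K).
  apply/funext => K; rewrite /pseries /series /= mulr_sumr.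
  by apply: eq_bigr => k _; rewrite mulrA.
by apply: cvgM; [exact: cvg_cst|exact: hf].
Qed.

Lemma entire_boundD f g N M : entire_bound f N -> entire_bound g M ->
  entire_bound (fun u => f u + g u) (fun r => N r + M r).
Proof.
case=> c h hf [d h' hg]; exists (fun k => c k + d k) => [r K r0|u].
  apply: (@le_trans _ _ (series (fun k => `|c k| * r ^+ k) K +
    series (fun k => `|d k| * r ^+ k) K)); last by apply: lerD; [exact: h|exact: h'].
  rewrite /series /= -big_split /=; apply: ler_sum => k _.
  by rewrite -mulrDl ler_wpM2r ?exprn_ge0// ler_normD.
have -> : pseries (fun k => c k + d k) u = (fun K => pseries c u K + pseries d u K).
  apply/funext => K; rewrite /pseries /series /= -big_split /=.
  by apply: eq_bigr => k _; rewrite mulrDl.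
by apply: cvgD; [exact: hf|exact: hg].
Qed.

Lemma entire_bound_mulX f N : entire_bound f N ->
  entire_bound (fun u => u * f u) (fun r => r * N r).
Proof.
case=> c h hf; exists (fun k => if k is k'.+1 then c k' else 0) => [r [|K] r0|u].
- by rewrite /series /= big_geq// mulr_ge0//; exact: psummable_ge0 h _.
- rewrite /series /= big_nat_recl//= normr0 mul0r add0r.
  under eq_bigr do rewrite exprS mulrCA.
  by rewrite -mulr_sumr ler_wpM2l//; exact: h.
rewrite -cvg_shiftS.
have -> : (fun n => pseries (fun k => if k is k'.+1 then c k' else 0) u n.+1) =
    (fun K => u * pseries c u K).
  apply/funext => K; rewrite /pseries /series /= big_nat_recl//= mul0r add0r.
  by rewrite mulr_sumr; apply: eq_bigr => k _; rewrite exprS mulrCA.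
by apply: cvgM; [exact: cvg_cst|exact: hf].
Qed.

Lemma entire_bound_cst l : entire_bound (fun=> l) (fun=> `|l|).
Proof.
have E r x K : series (fun k => (if k is 0%N then x else 0) * r ^+ k) K.+1 = x :> R.
  rewrite /series /= big_nat_recl//= expr0 mulr1 big1_seq ?addr0// => i _.
  by rewrite mul0r.
exists (fun k => if k is 0%N then l else 0) => [r [|K] r0|u].
- by rewrite /series /= big_geq.
- rewrite le_eqVlt -[X in _ == X](E r _ K); apply/orP; left; apply/eqP.
  by apply: eq_bigr => -[|k] _ //; rewrite normr0.
rewrite -cvg_shiftS.
by rewrite (_ : (fun n => _) = cst l); [exact: cvg_cst|apply/funext => n; exact: E].
Qed.

(** No Cauchy product is needed: [f * g] is the sum of the functions [c k * (u ^+ k * g u)], whose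
    norms are summable. *)
Lemma entire_boundM f g N M : entire_bound f N -> entire_bound g M ->
  entire_bound (fun u => f u * g u) (fun r => N r * M r).
Proof.
move=> [c h hf] hg.
have hk k : entire_bound (fun u => c k * (u ^+ k * g u))
    (fun r => `|c k| * (r ^+ k * M r)).
  apply: entire_boundZ; elim: k => [|k ih].
    apply: entire_bound_ext (entire_bound_le hg _) _ => [r _|u];
      by rewrite expr0 mul1r.
  apply: entire_bound_ext (entire_bound_le (entire_bound_mulX ih) _) _ => [r _|u];
    by rewrite exprS mulrA.
apply: (entire_bound_series hk) => [r m r0|u].
  rewrite /series /=; under eq_bigr do rewrite mulrA.
  rewrite -mulr_suml ler_wpM2r//; first exact: entire_bound_ge0 hg _.
  exact: h.
have -> : series (fun n => c n * (u ^+ n * g u)) = (fun K => pseries c u K * g u).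
  apply/funext => K; rewrite /pseries /series /= mulr_suml.
  by apply: eq_bigr => k _; rewrite mulrA.
by apply: cvgM; [exact: hf|exact: cvg_cst].
Qed.

Lemma entire_boundX f N k : entire_bound f N ->
  entire_bound (fun u => f u ^+ k) (fun r => N r ^+ k).
Proof.
move=> h; elim: k => [|k ih].
  apply: entire_bound_le (entire_bound_cst 1) _ => r _.
  by rewrite normr1 expr0.
apply: entire_bound_ext (entire_bound_le (entire_boundM h ih) _) _ => [r _|u];
  by rewrite exprS.
Qed.

Lemma entire_bound_expR l :
  entire_bound (fun u => expR (l * u)) (fun r => expR (`|l| * r)).
Proof.
exists (fun k => l ^+ k / k`!%:R) => [r K r0|u].
  have -> : (fun k => `|l ^+ k / k`!%:R| * r ^+ k) = exp_coeff (`|l| * r).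
    apply/funext => k; rewrite /exp_coeff /= exprMn normrM normrX.
    by rewrite normfV (ger0_norm (ler0n _ _)) mulrAC.
  have := @is_cvg_series_exp_coeff _ (`|l| * r) => /nondecreasing_cvgn_le.
  apply=> m n mn; apply: le_series_pos mn => k; apply: exp_coeff_ge0.
  by rewrite mulr_ge0.
have -> : pseries (fun k => l ^+ k / k`!%:R) u = series (exp_coeff (l * u)).
  by apply/funext => K; apply: eq_bigr => k _; rewrite /exp_coeff /= exprMn mulrAC.
exact: is_cvg_series_exp_coeff.
Qed.

Lemma entire_bound_scale l f N : entire_bound f N ->
  entire_bound (fun u => f (l * u)) (fun r => N (`|l| * r)).
Proof.
case=> c h hf; exists (fun k => c k * l ^+ k) => [r K r0|u].
  have := h (`|l| * r) K; rewrite mulr_ge0// => /(_ isT); apply: le_trans.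
  apply: ler_sum => k _.
  by rewrite normrM normrX exprMn mulrA.
have -> : pseries (fun k => c k * l ^+ k) u = pseries c (l * u).
  by apply/funext => K; apply: eq_bigr => k _ /=; rewrite exprMn mulrA.
exact: hf.
Qed.

(** Recentring at [t]: the powers [(t + u) ^+ k] are polynomials in [u] of norm at most
    [(|t| + r) ^+ k], and their combination is again a summable series of entire functions. *)
Lemma entire_bound_translate t f N : entire_bound f N ->
  entire_bound (fun u => f (t + u)) (fun r => N (`|t| + r)).
Proof.
case=> c h hf.
have id1 : entire_bound (fun u => t + u) (fun r => `|t| + r).
  apply: entire_boundD; first exact: entire_bound_cst.
  apply: entire_bound_ext (entire_bound_le (entire_bound_mulX (entire_bound_cst 1)) _) _;
    by move=> *; rewrite ?normr1 mulr1.
apply: (entire_bound_series (fun k => entire_boundZ (c k) (entire_boundX k id1))).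
  by move=> r m r0; apply: h; rewrite addr_ge0.
by move=> u; exact: hf.
Qed.

(** Differentiation costs a larger radius: [k.+1] is absorbed by [2 ^+ k.+1], and [r + 1 >= 1]
    allows the exponent to rise from [k] to [k.+1]. *)
Lemma psummable_diffs c N : psummable c N ->
  psummable (pseries_diffs c) (fun r => N (2 * (r + 1))).
Proof.
move=> h r K r0.
have r10 : 0 <= 2 * (r + 1) by rewrite mulr_ge0// addr_ge0.
apply: le_trans (h (2 * (r + 1)) K.+1 r10).
rewrite /series /= big_nat_recl//=.
apply: ler_wpDl; first by rewrite mulr_ge0.
apply: ler_sum => k _; rewrite /pseries_diffs normrM mulrAC mulrC.
rewrite ler_wpM2l// exprMn ler_pM ?exprn_ge0//.
  by rewrite ger0_norm// -natrX ler_nat ltnW// ltn_expl.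
apply: (@le_trans _ _ ((r + 1) ^+ k)).
  by rewrite lerXn2r ?nnegrE ?addr_ge0// lerDl.
by rewrite exprS ler_peMl ?exprn_ge0 ?addr_ge0// lerDr.
Qed.

Lemma is_derive_pseries c N u : psummable c N ->
  is_derive u 1 (fun v => limn (pseries c v)) (limn (pseries (pseries_diffs c) u)).
Proof.
move=> h; apply: (@pseries_snd_diffs _ _ (`|u| + 1)).
- exact: psummable_cvg h.
- exact: psummable_cvg (psummable_diffs h).
- exact: psummable_cvg (psummable_diffs (psummable_diffs h)).
- by rewrite [ltRHS]ger0_norm ?addr_ge0// ltrDl.
Qed.

Lemma psummable_iter_diffs c N n : psummable c N ->
  exists M, psummable (iter n (@pseries_diffs R) c) M.
Proof.
move=> h; elim: n => [|n [M hM]]; first by exists N.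
by exists (fun r => M (2 * (r + 1))); exact: psummable_diffs.
Qed.

Lemma derive1n_pseries c N n : psummable c N ->
  derive1n n (fun v => limn (pseries c v)) =
  (fun v => limn (pseries (iter n (@pseries_diffs R) c) v)).
Proof.
move=> h; elim: n => [//|n ih].
rewrite derive1nS ih; apply/funext => u; rewrite derive1E.
have [M hM] := psummable_iter_diffs n h.
by case: (is_derive_pseries u hM).
Qed.

Lemma iter_pseries_diffsE c n k :
  iter n (@pseries_diffs R) c k * k`!%:R = (n + k)`!%:R * c (n + k)%N.
Proof.
elim: n k => [|n ih] k; first by rewrite mulrC.
rewrite iterS {1}/pseries_diffs addSnnS -ih factS natrM; ring.
Qed.

Lemma limn_pseries0 c : limn (pseries c 0) = c 0%N.
Proof.
apply/cvg_lim => //; rewrite -cvg_shiftS.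
rewrite (_ : (fun n => _) = cst (c 0%N)); first exact: cvg_cst.
apply/funext => n; rewrite /pseries /series /= big_nat_recl//= expr0 mulr1.
by rewrite big1_seq ?addr0// => i _; rewrite expr0n mulr0.
Qed.

Lemma derive1n_translate t f n :
  derive1n n (fun v => f (t + v)) = (fun v => derive1n n f (t + v)).
Proof.
elim: n => [//|n ih]; rewrite !derive1nS ih; apply/funext => u.
rewrite /derive1.
have -> : (fun h => h^-1 *: (derive1n n f (t + (h + u)) - derive1n n f (t + u))) =
    (fun h => h^-1 *: (derive1n n f (h + (t + u)) - derive1n n f (t + u))).
  by apply/funext => h; rewrite addrCA.
by [].
Qed.

(** After recentring at [t], the derivatives at [t] are factorials times the coefficients. The shift
    series is then the recentred power series at [- k], convergent for any [k] because the radius is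
    infinite. *)
Lemma entire_bound_shift f N k t : entire_bound f N -> shift_well_defined k f t.
Proof.
move=> hf; split.
  move=> n u; have [c h hc] := hf.
  have -> : f = (fun v => limn (pseries c v)).
    by apply/funext => v; apply/esym/cvg_lim => //; exact: hc.
  rewrite (derive1n_pseries n h); have [M hM] := psummable_iter_diffs n h.
  by case: (is_derive_pseries u hM).
have [c h hc] := entire_bound_translate t hf.
have fE : (fun v => f (t + v)) = (fun v => limn (pseries c v)).
  by apply/funext => v; apply/esym/cvg_lim => //; exact: hc.
have dE n : derive1n n f t = n`!%:R * c n.
  have := congr1 (fun F => F 0) (derive1n_translate t f n).
  rewrite fE (derive1n_pseries n h) /= limn_pseries0 addr0 => <-.
  by have := iter_pseries_diffsE c n 0; rewrite addn0 fact0 mulr1.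
have -> : shift_series k f t = pseries c (- k).
  apply/funext => K; apply: eq_bigr => n _ /=.
  rewrite dE mulrA divfK ?pnatr_eq0 -?lt0n ?fact_gt0//.
  by rewrite mulrC.
exact: hc.
Qed.

End entire.

(** * The reciprocal Gamma function is entire *)

Section reciprocal_gamma_entire.
Context {R : realType}.
Implicit Types (r u z : R).

Lemma series_exp_coeff_le r K : 0 <= r -> series (exp_coeff r) K <= expR r.
Proof.
move=> r0; have := @is_cvg_series_exp_coeff _ r => /nondecreasing_cvgn_le.
by apply; apply: le_series_pos => k; exact: exp_coeff_ge0.
Qed.

(** Both sides are [ln (1 + x) <= x], the left one being applied to the inverse ratio. *)
Lemma ln_succ_ratio_itv k :
  k.+2%:R^-1 <= ln (k.+2%:R / k.+1%:R : R) <= k.+1%:R^-1.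
Proof.
have k1 : (0 : R) < k.+1%:R by rewrite ltr0n.
have k2 : (0 : R) < k.+2%:R by rewrite ltr0n.
apply/andP; split.
  have -> : k.+2%:R / k.+1%:R = (1 + - k.+2%:R^-1)^-1 :> R.
    rewrite -(natr1 k.+1); move: (k.+1%:R : R) k1 => x x0.
    have x1 : x + 1 != 0 by rewrite gt_eqF// addr_gt0.
    have -> : 1 - (x + 1)^-1 = x / (x + 1) by field.
    by rewrite invf_div.
  have p0 : (0 : R) < 1 + - k.+2%:R^-1.
    by rewrite subr_gt0 invf_lt1// ltr1n.
  rewrite lnV ?posrE// lerNr; apply: le_ln1Dx.
  by rewrite ltrN2 invf_lt1// ltr1n.
have -> : k.+2%:R / k.+1%:R = 1 + k.+1%:R^-1 :> R.
  by rewrite -(natr1 k.+1); field; rewrite gt_eqF.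
apply: le_ln1Dx; apply: (@lt_trans _ _ 0); rewrite ?invr_gt0//.
Qed.

(** The function is [(1 + h z) exp(- l z) - 1] with [h = 1 / k.+1] and [0 <= l <= h]. Its constant
    coefficient vanishes, the linear one is [h - l <= h ^+ 2], and every later one contains at least
    two factors among [h] and [l]. This square makes the product converge. *)
Lemma euler_factor_bound k :
  entire_bound (fun z : R => euler_factor k.+1 z - 1)
    (fun r => 2 / k.+1%:R ^+ 2 * (r * expR r)).
Proof.
set l := ln (k.+2%:R / k.+1%:R : R); set h : R := k.+1%:R^-1.
have h0 : 0 < h by rewrite invr_gt0 ltr0n.
have h1 : h <= 1 by rewrite invf_le1 ?ltr0n// ler1n.
have /andP[l1 l2] := ln_succ_ratio_itv k; rewrite -/l -/h in l1 l2.
have l0 : 0 <= l by apply: le_trans l1; rewrite invr_ge0.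
have hl : h - l <= h ^+ 2.
  apply: (@le_trans _ _ (h - k.+2%:R^-1)); first by rewrite lerB.
  rewrite /h -(natr1 k.+1); set x : R := k.+1%:R.
  have x0 : 0 < x by rewrite ltr0n.
  rewrite -subr_ge0.
  have -> : x^-1 ^+ 2 - (x^-1 - (x + 1)^-1) = (x ^+ 2 * (x + 1))^-1.
    by field; rewrite !gt_eqF// addr_gt0.
  by rewrite invr_ge0 mulr_ge0 ?exprn_ge0 ?addr_ge0 ?ltW.
pose c j : R := if j is i.+1 then (- l) ^+ i.+1 / i.+1`!%:R + h * ((- l) ^+ i / i`!%:R)
  else 0.
have cle j : `|c j.+1| <= 2 * h ^+ 2 / j`!%:R.
  case: j => [|j] /=.
    rewrite expr1 expr0 fact0 (_ : 1`! = 1%N)// !divr1 mulr1 addrC.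
    rewrite ger0_norm ?subr_ge0//.
    by apply: le_trans hl _; rewrite ler_peMl ?exprn_ge0 ?(ltW h0)// ler1n.
  have lj i : l ^+ i <= h ^+ i by rewrite lerXn2r ?nnegrE// ltW.
  have ji : (j.+2`!%:R : R)^-1 <= (j.+1`!%:R)^-1.
    rewrite lef_pV2 ?posrE ?ltr0n ?fact_gt0// ler_nat [leqRHS]factS.
    by rewrite leq_pmull.
  have hj i : h ^+ i.+2 <= h ^+ 2.
    rewrite -addn2 exprD ler_piMl ?exprn_ge0 ?(ltW h0)//.
    by rewrite exprn_ile1// (ltW h0).
  apply: le_trans (ler_normD _ _) _.
  have -> : 2 * h ^+ 2 / j.+1`!%:R = h ^+ 2 / j.+1`!%:R + h ^+ 2 / j.+1`!%:R.
    by ring.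
  rewrite !normrM !normfV !normrX normrN (ger0_norm l0) !(ger0_norm (ler0n _ _)).
  rewrite -exprS -/h; apply: lerD.
    apply: ler_pM => //; rewrite ?exprn_ge0 ?invr_ge0//.
    by apply: le_trans (lj _) _.
  rewrite mulrA ler_wpM2r ?invr_ge0//; apply: le_trans (hj j).
  by rewrite [leRHS]exprS ler_wpM2l ?(ltW h0).
exists c => [r K r0|z].
  have -> : 2 / k.+1%:R ^+ 2 * (r * expR r) = 2 * h ^+ 2 * r * expR r.
    by rewrite /h exprVn !mulrA.
  have d0 : 0 <= 2 * h ^+ 2 * r by rewrite !mulr_ge0 ?exprn_ge0 ?(ltW h0).
  case: K => [|K].
    by rewrite /series /= big_geq// mulr_ge0// expR_ge0.
  rewrite /series /= big_nat_recl//= normr0 mul0r add0r.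
  apply: le_trans (ler_wpM2l d0 (series_exp_coeff_le K r0)).
  rewrite /series /= mulr_sumr; apply: ler_sum => j _.
  have := ler_wpM2r (exprn_ge0 j.+1 r0) (cle j); move=> /le_trans; apply.
  by rewrite le_eqVlt; apply/orP; left; apply/eqP; rewrite /exp_coeff /= (exprS r); ring.
rewrite -cvg_shiftS.
have -> : (fun K => pseries c z K.+1) = (fun K =>
   series (exp_coeff (- (z * l))) K.+1 - 1 +
   z / k.+1%:R * series (exp_coeff (- (z * l))) K).
  apply/funext => K; rewrite /pseries /series /= !big_nat_recl//= mul0r add0r.
  have -> : exp_coeff (- (z * l)) 0%N = 1 by rewrite /exp_coeff /= expr0 fact0 divr1.
  rewrite (addrC 1) addrK mulr_sumr -big_split /=.
  apply: eq_bigr => j _; rewrite /exp_coeff /= -mulrN mulrC -/h !exprMn !exprS; ring.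
have E := @is_cvg_series_exp_coeff _ (- (z * l)).
have -> : euler_factor k.+1 z - 1 =
    expR (- (z * l)) - 1 + z / k.+1%:R * expR (- (z * l)).
  by rewrite /euler_factor -/l; ring.
apply: cvgD; last by apply: cvgM; [exact: cvg_cst|exact: E].
by apply: cvgB; [rewrite cvg_shiftS; exact: E|exact: cvg_cst].
Qed.

(** The bound [2 - 1/m] is what makes the induction go through, since [1/(m+1)^2] is less than
    [1/m - 1/(m+1)]. At [m = 0] it reads 2, as [0^-1 = 0]. *)
Lemma sum_invsq_le n m : \sum_(0 <= i < m) ((n.+1 + i)%:R ^+ 2)^-1 <= 2 :> R.
Proof.
suff h : \sum_(0 <= i < m) ((n.+1 + i)%:R ^+ 2)^-1 <= 2 - m%:R^-1 :> R.
  by apply: le_trans h _; rewrite gerBl invr_ge0.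
have h i : ((n.+1 + i)%:R ^+ 2)^-1 <= (i.+1%:R ^+ 2)^-1 :> R.
  rewrite lef_pV2 ?posrE ?exprn_gt0 ?ltr0n//.
  by rewrite lerXn2r ?nnegrE// ler_nat addSn ltnS leq_addl.
case: m => [|m]; first by rewrite big_geq// invr0 subr0.
elim: m => [|m ih].
  by rewrite big_nat1; apply: le_trans (h 0%N) _; rewrite expr1n invr1; lra.
rewrite big_nat_recr//=; apply: le_trans (lerD ih (h _)) _.
rewrite -(natr1 m.+1).
have : (0 : R) < m.+1%:R by rewrite ltr0n.
move: (m.+1%:R : R) => x x0.
have x10 : 0 < x + 1 by lra.
rewrite -subr_ge0.
have -> : 2 - (x + 1)^-1 - (2 - x^-1 + ((x + 1) ^+ 2)^-1) = (x * (x + 1) ^+ 2)^-1.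
  by field; rewrite !gt_eqF.
by rewrite invr_ge0 mulr_ge0 ?exprn_ge0 ?ltW.
Qed.

(** The infinite product is turned into a series by telescoping its partial products. Since
    [1 + e <= exp e], the norms are bounded by the exponential of a sum; 4 is the 2 of a single
    factor times the 2 bounding the sum of inverse squares. *)
Lemma prod_euler_factor_bound n :
  entire_bound (fun z : R => Gamma n.+1%:R * n.+1%:R `^ z * rGamma (n.+1%:R + z))
    (fun r => expR (4 * (r * expR r))).
Proof.
pose e k r : R := 2 / (n.+1 + k)%:R ^+ 2 * (r * expR r).
have e0 k r : 0 <= r -> 0 <= e k r.
  by move=> r0; rewrite /e !mulr_ge0 ?invr_ge0 ?exprn_ge0 ?expR_ge0.
pose Q m z : R := \prod_(i < m) euler_factor (n.+1 + i) z.
pose P m r : R := \prod_(i < m) (1 + e i r).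
(* The increments [Q k.+1 - Q k], preceded by the empty product 1. Their norms [N] telescope in the
   same way to [P]. *)
pose f m z := if m is k.+1 then Q k z * (euler_factor (n.+1 + k) z - 1) else 1.
pose N m r := if m is k.+1 then P k r * e k r else 1.
have ef k : entire_bound (fun z => euler_factor (n.+1 + k) z - 1) (e k).
  exact: euler_factor_bound.
have hQ m : entire_bound (Q m) (P m).
  elim: m => [|m ih].
    apply: entire_bound_ext (entire_bound_le (entire_bound_cst 1) _) _ => [r _|z].
      by rewrite normr1 /P big_ord0.
    by rewrite /Q big_ord0.
  have h := entire_boundD (entire_bound_cst 1) (ef m).
  apply: entire_bound_ext (entire_bound_le (entire_boundM ih h) _) _ => [r _|z].
    by rewrite /P big_ord_recr /= normr1.
  by rewrite /Q big_ord_recr /= addrC subrK.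
have fE z : (fun m => series (f ^~ z) m.+1) = Q ^~ z.
  apply/funext; elim => [|m ih]; rewrite /series /= big_nat_recr//=.
    by rewrite big_geq// add0r /Q big_ord0.
  by move: ih; rewrite /series /= => ->; rewrite /Q big_ord_recr /=; ring.
have NE r m : series (N ^~ r) m.+1 = P m r.
  elim: m => [|m ih]; rewrite /series /= big_nat_recr//=.
    by rewrite big_geq// add0r /P big_ord0.
  by move: ih; rewrite /series /= => ->; rewrite /P big_ord_recr /=; ring.
apply: (@entire_bound_series _ f N).
- case=> [|k]; last by apply: entire_boundM.
  by apply: entire_bound_le (entire_bound_cst 1) _ => r _; rewrite normr1.
- move=> r [|m] r0; first by rewrite /series /= big_geq// expR_ge0.
  rewrite NE /P.
  apply: (@le_trans _ _ (\prod_(i < m) expR (e i r))).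
    apply: ler_prod => i _; rewrite addr_ge0 ?e0//=; exact: expR_ge1Dx.
  rewrite -expR_sum ler_expR /e -mulr_suml ler_wpM2r//.
    by rewrite mulr_ge0// expR_ge0.
  rewrite -mulr_sumr; have := sum_invsq_le n m; rewrite big_mkord => h.
  have -> : 4 = 2 * 2 :> R by rewrite -natrM.
  by rewrite ler_wpM2l.
move=> z; rewrite -cvg_shiftS fE; exact: rGamma_euler_product.
Qed.

(** [n + r <= exp n * exp r] contributes one factor to each definition; [(n+1) ^ r <= exp (n * r)]
    completes the base, and the bounds on [1 / Gamma (n+1)] and on Euler's product complete the
    constant. *)
Definition rGamma_cst r : R := (Gamma 1)^-1 * expR r * expR (4 * (r * expR r)).
Definition rGamma_base r : R := expR (r + 1).

Lemma Gamma_nat_ge n : Gamma 1 <= Gamma n.+1%:R :> R.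
Proof.
elim: n => [//|n ih]; rewrite -natr1 GammaD1 ?ltr0n//.
apply: le_trans ih _; rewrite ler_peMl ?ler1n//; apply: ltW.
by rewrite Gamma_gt0 ?ltr0n.
Qed.

(** One use of the functional equation descends from [n + 1] to [n], so that [n = 0], the prefactor
    [1/Gamma(lambda t)], is covered. The decay of [1 / Gamma (n+1)] is given up: exponential growth
    suffices. *)
Lemma rGamma_bound n :
  entire_bound (fun z : R => rGamma (n%:R + z))
    (fun r => rGamma_cst r * rGamma_base r ^+ n).
Proof.
have h1 := entire_boundM (entire_bound_expR (- ln (n.+1%:R : R)))
   (entire_boundZ (Gamma n.+1%:R)^-1 (prod_euler_factor_bound n)).
have h2 : entire_bound (fun z : R => n%:R + z) (fun r => n%:R + r).
  apply: entire_bound_ext (entire_bound_le (entire_boundD (entire_bound_cst n%:R)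
    (entire_bound_mulX (entire_bound_cst 1))) _) _ => [r _|z].
    by rewrite normr1 mulr1 ger0_norm.
  by rewrite mulr1.
apply: entire_bound_ext (entire_bound_le (entire_boundM h2 h1) _) _ => [r r0|z].
  have ln0 : 0 <= ln (n.+1%:R : R) by rewrite ln_ge0// ler1n.
  have lnn : ln (n.+1%:R : R) <= n%:R.
    rewrite -natr1 addrC; apply: le_ln1Dx; apply: lt_le_trans (ler0n _ n).
    by rewrite oppr_lt0.
  have G1 := @Gamma_gt0 R 1 ltr01.
  have Gn : 0 < Gamma (n.+1%:R : R) by rewrite Gamma_gt0.
  have Gi : 0 <= (Gamma (n.+1%:R : R))^-1 by rewrite invr_ge0 ltW.
  rewrite normrN (ger0_norm ln0) (ger0_norm Gi).
  have -> : rGamma_cst r * rGamma_base r ^+ n = (expR n%:R * expR r) *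
     (expR (n%:R * r) * ((Gamma 1)^-1 * expR (4 * (r * expR r)))).
    rewrite /rGamma_cst /rGamma_base -expRM_natl mulrDr mulr1 expRD; ring.
  apply: ler_pM; rewrite ?addr_ge0 ?mulr_ge0 ?expR_ge0 ?Gi//.
    rewrite -expRD; apply: le_trans (expR_ge1Dx _).
    by rewrite lerDr.
  apply: ler_pM; rewrite ?mulr_ge0 ?expR_ge0 ?Gi//.
    by rewrite ler_expR ler_wpM2r.
  rewrite ler_wpM2r ?expR_ge0// lef_pV2 ?posrE//.
  exact: Gamma_nat_ge.
have Gn : 0 < Gamma (n.+1%:R : R) by rewrite Gamma_gt0.
rewrite (rGammaD1 (n%:R + z)) addrAC natr1; congr (_ * _).
move: (rGamma (n.+1%:R + z)) => G.
have -> : expR (- ln (n.+1%:R : R) * z) = (n.+1%:R `^ z)^-1.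
  by rewrite /powR pnatr_eq0 /= -expRN mulNr mulrC.
have : n.+1%:R `^ z != 0 by rewrite gt_eqF// powR_gt0 ltr0n.
by move=> p0; field; rewrite p0 gt_eqF.
Qed.

End reciprocal_gamma_entire.

(** * The differential equation *)

Section differential_equation.
Context {R : realType}.
Implicit Types (c b m : R^nat) (a s t theta lambda x y : R).

Lemma powRD_gt0 x s t : 0 < x -> x `^ (s + t) = x `^ s * x `^ t.
Proof. by move=> x0; rewrite powRD// (gt_eqF x0) implybT. Qed.

Lemma powRB1_gt0 s x : 0 < x -> x `^ (s - 1) = x `^ s / x.
Proof. by move=> x0; rewrite powRD_gt0// powR_inv1// ltW. Qed.

(** The factors that [1/n!] absorbs. This class contains affine functions of [n], geometric
    sequences and [1/Gamma(n + s)], and is closed under products; through [entire_coefM] it settles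
    the convergence of the density series and of its derivatives. *)
Definition exp_growth m := exists A B : R, forall n, `|m n| <= A * B ^+ n.

Definition entire_coef c := exists N, psummable c N.

Lemma exp_growth_ge0 m : exp_growth m ->
  exists A B : R, [/\ 0 <= A, 0 <= B & forall n, `|m n| <= A * B ^+ n].
Proof.
case=> A [B h]; exists `|A|, `|B|; split => // n.
by apply: le_trans (h n) _; rewrite -normrX -normrM ler_norm.
Qed.

Lemma exp_growthM m1 m2 : exp_growth m1 -> exp_growth m2 ->
  exp_growth (fun n => m1 n * m2 n).
Proof.
move=> [A [B h]] [A' [B' h']]; exists (A * A'), (B * B') => n.
by rewrite exprMn normrM mulrACA ler_pM.
Qed.

Lemma exp_growth_cst y : exp_growth (fun=> y).
Proof. by exists `|y|, 1 => n; rewrite expr1n mulr1. Qed.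

Lemma exp_growthX y : exp_growth (fun n => y ^+ n).
Proof. by exists 1, `|y| => n; rewrite mul1r normrX. Qed.

Lemma exp_growth_affine x y : exp_growth (fun n => x * n%:R + y).
Proof.
exists (`|x| + `|y|), 2 => n; apply: le_trans (ler_normD _ _) _.
rewrite normrM mulrDl (ger0_norm (ler0n _ _)) -natrX; apply: lerD.
  by rewrite ler_wpM2l// ler_nat ltnW// ltn_expl.
by rewrite ler_peMr// ler1n expn_gt0.
Qed.

Lemma exp_growth_expn m k : exp_growth m -> exp_growth (fun n => m n ^+ k).
Proof.
move=> h; elim: k => [|k ih]; first exact: exp_growth_cst.
by under eq_fun do rewrite exprS; exact: exp_growthM.
Qed.

Lemma exp_growth_prod (I : Type) (r : seq I) (P : pred I) (m : I -> R^nat) :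
  (forall i, exp_growth (m i)) -> exp_growth (fun n => \prod_(i <- r | P i) m i n).
Proof.
move=> h; elim: r => [|i r ih].
  by under eq_fun do rewrite big_nil; exact: exp_growth_cst.
under eq_fun do rewrite big_cons; case: (P i) => //; exact: exp_growthM.
Qed.

Lemma entire_coefM c m : entire_coef c -> exp_growth m ->
  entire_coef (fun n => c n * m n).
Proof.
move=> [N hN] /exp_growth_ge0[A [B [A0 B0 h]]].
exists (fun r => A * N (B * r)) => r K r0.
have Br : 0 <= B * r by rewrite mulr_ge0.
apply: le_trans (ler_wpM2l A0 (hN _ K Br)).
rewrite /series /= mulr_sumr; apply: ler_sum => n _.
rewrite normrM exprMn.
have -> : A * (`|c n| * (B ^+ n * r ^+ n)) = `|c n| * (A * B ^+ n) * r ^+ n by ring.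
by rewrite ler_wpM2r ?exprn_ge0// ler_wpM2l.
Qed.

Lemma entire_coef_cvg c y : entire_coef c -> cvgn (series (fun n => c n * y ^+ n)).
Proof. by case=> N h; exact: psummable_cvg h. Qed.

Lemma entire_coef_cvg1 c : entire_coef c -> cvgn (series c).
Proof.
move=> h; have := @entire_coef_cvg _ 1 h.
by under eq_fun do rewrite expr1n mulr1.
Qed.

Lemma entire_coef_invfact : entire_coef (fun n => n`!%:R^-1).
Proof.
exists expR => r K r0; apply: le_trans (series_exp_coeff_le K r0).
apply: ler_sum => n _; rewrite /exp_coeff /= ger0_norm ?invr_ge0//.
by rewrite mulrC.
Qed.

Lemma exp_growth_rGamma s : exp_growth (fun n => rGamma (n%:R + s)).
Proof.
exists (rGamma_cst `|s|), (rGamma_base `|s|) => n.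
exact: (entire_bound_norm s (rGamma_bound n)).
Qed.

Definition density_coef (q : nat) theta s (n : nat) : R :=
  theta ^+ n / n`!%:R * rGamma (n%:R + s) ^+ (q - 1).

Definition density_factor a s (n : nat) y : R :=
  (a * y) `^ (n%:R + s) / y * expR (- (a * y)).

Lemma entire_coef_density q theta s : entire_coef (density_coef q theta s).
Proof.
have := entire_coefM entire_coef_invfact
  (exp_growthM (exp_growthX theta) (exp_growth_expn (q - 1) (exp_growth_rGamma s))).
rewrite (_ : (fun _ => _) = density_coef q theta s)//.
by apply/funext => n; rewrite /density_coef mulrCA mulrA.
Qed.

Lemma density_factor0 a s n y : 0 < a -> 0 < y ->
  density_factor a s n y = (a * y) ^+ n * density_factor a s 0 y.
Proof.
move=> a0 y0; have ay : 0 < a * y by rewrite mulr_gt0.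
rewrite /density_factor add0r powRD_gt0//.
by rewrite powR_mulrn ?(ltW ay)// !mulrA.
Qed.

Lemma density_factorS a s n y :
  density_factor a (s - 1) n.+1 y = density_factor a s n y.
Proof.
rewrite /density_factor; have -> : n.+1%:R + (s - 1) = n%:R + s; last by [].
by rewrite -natr1; ring.
Qed.

Lemma density_factor_div a s n y : 0 < a -> 0 < y ->
  density_factor a s n y / y = a * density_factor a (s - 1) n y.
Proof.
move=> a0 y0; have ay : 0 < a * y by rewrite mulr_gt0.
rewrite /density_factor; have -> : n%:R + s = n%:R + (s - 1) + 1 by ring.
rewrite powRD_gt0// powRr1 ?ltW//; field; by rewrite gt_eqF.
Qed.

Lemma exp_growth_density_factor a s y : 0 < a -> 0 < y ->
  exp_growth (fun n => density_factor a s n y).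
Proof.
move=> a0 y0.
under eq_fun do rewrite density_factor0//.
apply: exp_growthM; [exact: exp_growthX|exact: exp_growth_cst].
Qed.

Definition density_logderiv a s (n : nat) y : R := (n%:R + s - 1) / y - a.

Lemma exp_growth_logderiv a s y : exp_growth (fun n => density_logderiv a s n y).
Proof.
have := exp_growth_affine y^-1 ((s - 1) / y - a).
rewrite (_ : (fun _ => _) = (fun n => density_logderiv a s n y))//.
by apply/funext => n; rewrite /density_logderiv; ring.
Qed.

Lemma is_derive_density_factor0 a s y : 0 < a -> 0 < y ->
  is_derive y 1 (density_factor a s 0)
    (density_factor a s 0 y * density_logderiv a s 0 y).
Proof.
move=> a0 y0; have ay : 0 < a * y by rewrite mulr_gt0.
have h1 : is_derive y 1 (fun v => a `^ s * v `^ (s - 1) * expR (- (a * v)))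
    (a `^ s * y `^ (s - 1) * (- a * expR (- (a * y))) +
     expR (- (a * y)) * (a `^ s * ((s - 1) * y `^ (s - 1 - 1)))).
  have d1 : is_derive y 1 (fun v : R => a `^ s * v `^ (s - 1))
      (a `^ s * ((s - 1) * y `^ (s - 1 - 1))).
    have := is_derive_powRl (s - 1) y0 => d; exact: is_deriveZ.
  have d2 : is_derive y 1 (fun v : R => expR (- (a * v))) (- a * expR (- (a * y))).
    apply: trigger_derive; rewrite /= !scaler1; ring.
  exact: is_deriveM.
have E v : 0 < v -> a `^ s * v `^ (s - 1) * expR (- (a * v)) = density_factor a s 0 v.
  move=> v0; rewrite /density_factor add0r powRM ?ltW//.
  by rewrite powRB1_gt0// !mulrA.
have : is_derive y 1 (density_factor a s 0)
    (a `^ s * y `^ (s - 1) * (- a * expR (- (a * y))) +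
     expR (- (a * y)) * (a `^ s * ((s - 1) * y `^ (s - 1 - 1)))).
  apply: near_eq_is_derive h1; near=> v; apply: E.
  by near: v; exact: lt_nbhsr.
rewrite (_ : _ + _ = density_factor a s 0 y * density_logderiv a s 0 y)//.
rewrite -E// /density_logderiv (powRB1_gt0 (s - 1))//.
by rewrite add0r; field; rewrite gt_eqF.
Unshelve. all: by end_near. Qed.

Lemma density_series_split a s b y : 0 < a -> 0 < y -> entire_coef b ->
  limn (series (fun n => b n * density_factor a s n y)) =
  limn (pseries b (a * y)) * density_factor a s 0 y.
Proof.
move=> a0 y0 hb; apply/cvg_lim => //.
have -> : series (fun n => b n * density_factor a s n y) =
    (fun K => pseries b (a * y) K * density_factor a s 0 y).
  apply/funext => K; rewrite /pseries /series /= mulr_suml.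
  by apply: eq_bigr => n _; rewrite density_factor0// mulrA.
by apply: cvgM; [exact: entire_coef_cvg|exact: cvg_cst].
Qed.

Lemma pseries_diffs_shift b y : entire_coef b ->
  series (fun n => n%:R * b n * y ^+ n) @ \oo -->
  y * limn (pseries (pseries_diffs b) y).
Proof.
case=> N /psummable_diffs hb; rewrite -cvg_shiftS.
have -> : (fun K => series (fun n => n%:R * b n * y ^+ n) K.+1) =
    (fun K => y * pseries (pseries_diffs b) y K).
  apply/funext => K; rewrite /pseries /series /= big_nat_recl//= !mul0r add0r mulr_sumr.
  by apply: eq_bigr => n _; rewrite /pseries_diffs exprS; ring.
by apply: cvgM; [exact: cvg_cst|exact: psummable_cvg hb].
Qed.

(** As a function of one coordinate, the series is a power series in [a * y] times the factor for
    [n = 0]. Termwise differentiation thus reduces to that of a power series and the product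
    rule. *)
Lemma is_derive_density_series a s b y : 0 < a -> 0 < y -> entire_coef b ->
  is_derive y 1 (fun v => limn (series (fun n => b n * density_factor a s n v)))
   (limn (series (fun n => b n * (density_factor a s n y * density_logderiv a s n y)))).
Proof.
move=> a0 y0 hb; have [N hN] := hb.
have d1 : is_derive y 1 (fun v => limn (pseries b (a * v)))
    (a * limn (pseries (pseries_diffs b) (a * y))).
  have h := is_derive_pseries (a * y) hN.
  have d0 : is_derive y 1 (fun v : R => a * v) a.
    by apply: trigger_derive; rewrite /= scaler1.
  have := is_derive1_comp h d0.
  by rewrite mulrC.
have d2 := is_deriveM d1 (is_derive_density_factor0 s a0 y0).
have d3 : is_derive y 1 (fun v => limn (series (fun n => b n * density_factor a s n v)))
    (limn (pseries b (a * y)) *: (density_factor a s 0 y * density_logderiv a s 0 y)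
    + density_factor a s 0 y *: (a * limn (pseries (pseries_diffs b) (a * y)))).
  apply: near_eq_is_derive d2; near=> v.
  rewrite density_series_split//; by near: v; exact: lt_nbhsr.
rewrite (_ : limn _ = limn (pseries b (a * y)) *:
   (density_factor a s 0 y * density_logderiv a s 0 y)
    + density_factor a s 0 y *: (a * limn (pseries (pseries_diffs b) (a * y))))//.
apply/cvg_lim => //.
have -> : series (fun n => b n * (density_factor a s n y * density_logderiv a s n y)) =
  (fun K => pseries b (a * y) K * (density_factor a s 0 y * density_logderiv a s 0 y) +
    density_factor a s 0 y / y * series (fun n => n%:R * b n * (a * y) ^+ n) K).
  apply/funext => K; rewrite /pseries /series /= mulr_suml mulr_sumr -big_split /=.
  apply: eq_bigr => n _; rewrite (density_factor0 s n a0 y0) /density_logderiv.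
  by rewrite add0r; ring.
apply: cvgD.
  by apply: cvgM; [exact: entire_coef_cvg|exact: cvg_cst].
have -> : density_factor a s 0 y *: (a * limn (pseries (pseries_diffs b) (a * y))) =
   density_factor a s 0 y / y * (a * y * limn (pseries (pseries_diffs b) (a * y))).
  by rewrite /GRing.scale /=; field; rewrite gt_eqF.
by apply: cvgM; [exact: cvg_cst|exact: pseries_diffs_shift].
Unshelve. all: by end_near. Qed.

(** Only the values of [f] on the line and near [x] matter, which is why a formula known merely on
    the open orthant can be differentiated. *)
Lemma is_derive_line q (f : 'rV[R]_q -> R) (x : 'rV[R]_q) (j : 'I_q)
    (phi : R -> R) (df : R) :
  (\forall h \near 0, f (h *: delta_mx ord0 j + x) = phi (h + x ord0 j)) ->
  is_derive (x ord0 j) 1 phi df -> is_derive x (delta_mx ord0 j) f df.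
Proof.
move=> fphi dphi.
have f0 : f x = phi (x ord0 j).
  by have := nbhs_singleton fphi; rewrite scale0r !add0r.
have E : h^-1 *: ((phi \o shift (x ord0 j)) (h *: 1) - phi (x ord0 j)) @[h --> 0^']
    --> df.
  by case: dphi => dphi <-; exact: dphi.
have F : h^-1 *: ((f \o shift x) (h *: delta_mx ord0 j) - f x) @[h --> 0^'] --> df.
  apply: cvg_trans E; apply: near_eq_cvg; near=> h.
  rewrite /= f0 scaler1; congr (_ *: (_ - _)); apply/esym.
  by near: h; exact: nbhs_dnbhs.
split; first by apply/cvg_ex; exists df.
exact/cvg_lim.
Unshelve. all: by end_near. Qed.

Definition partial_term q a s (js : seq 'I_q) (x : 'rV[R]_q) (n : nat) : R :=
  \prod_(i < q) (density_factor a s n (x ord0 i) *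
    (if i \in js then density_logderiv a s n (x ord0 i) else 1)).

(** The factors of the other coordinates, differentiated or not, are frozen into the coefficients
    [b]. Since [j] is not in [js], its own factor is still a plain [density_factor], and the
    one-variable lemma applies. *)
Lemma is_derive_partial q theta a s (js : seq 'I_q) (j : 'I_q) (K0 : R)
    (F : 'rV[R]_q -> R) (x : 'rV[R]_q) : 0 < a -> j \notin js -> orthant q x ->
  (forall y : 'rV[R]_q, orthant q y ->
    F y = K0 * limn (series (fun n => density_coef q theta s n * partial_term a s js y n))) ->
  is_derive x (delta_mx ord0 j) F
   (K0 * limn (series (fun n => density_coef q theta s n * partial_term a s (j :: js) x n))).
Proof.
move=> a0 jjs ox FE.
pose b n := density_coef q theta s n * \prod_(i < q | i != j)
  (density_factor a s n (x ord0 i) *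
    (if i \in js then density_logderiv a s n (x ord0 i) else 1)).
have hb : entire_coef b.
  apply: entire_coefM; first exact: entire_coef_density.
  apply: exp_growth_prod => i; apply: exp_growthM.
    by apply: exp_growth_density_factor => //; exact: ox.
  by case: (i \in js); [exact: exp_growth_logderiv|exact: exp_growth_cst].
have d := is_derive_density_series s a0 (ox j) hb.
have dK : is_derive (x ord0 j) 1
    (fun v => K0 * limn (series (fun n => b n * density_factor a s n v)))
    (K0 * limn (series (fun n => b n * (density_factor a s n (x ord0 j) *
       density_logderiv a s n (x ord0 j))))).
  exact: is_deriveZ.
have -> : (fun n => density_coef q theta s n * partial_term a s (j :: js) x n) =
    (fun n => b n * (density_factor a s n (x ord0 j) *
       density_logderiv a s n (x ord0 j))).
  apply/funext => n; rewrite /b /partial_term (bigD1 j)//= mem_head -mulrA.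
  congr (_ * _); rewrite mulrC; congr (_ * _); apply: eq_bigr => i ij.
  by rewrite in_cons (negbTE ij).
apply: is_derive_line dK; near=> h.
have hj : 0 < h + x ord0 j.
  near: h.
  have : (\forall h \near 0, - x ord0 j < h).
    by apply: lt_nbhsr; rewrite oppr_lt0; exact: ox.
  by apply: filterS => h; rewrite -subr_gt0 opprK.
have xE i : (h *: delta_mx ord0 j + x) ord0 i =
    if i == j then h + x ord0 j else x ord0 i.
  rewrite !mxE eqxx /=; case: eqVneq => [->|_]; first by rewrite mulr1.
  by rewrite mulr0 add0r.
rewrite FE; last by move=> i; rewrite xE; case: ifP => // _; exact: ox.
have -> : (fun n => density_coef q theta s n *
    partial_term a s js (h *: delta_mx ord0 j + x) n) =
    (fun n => b n * density_factor a s n (h + x ord0 j)); last by [].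
apply/funext => n.
rewrite /b /partial_term (bigD1 j)//= xE eqxx (negbTE jjs) mulr1 -mulrA.
congr (_ * _); rewrite mulrC; congr (_ * _); apply: eq_bigr => i ij.
by rewrite xE (negbTE ij).
Unshelve. all: by end_near. Qed.

Lemma mixed_partial_density q theta a s (js : seq 'I_q) (K0 : R)
    (F : 'rV[R]_q -> R) : 0 < a -> uniq js ->
  (forall y : 'rV[R]_q, orthant q y ->
    F y = K0 * limn (series (fun n => density_coef q theta s n * partial_term a s [::] y n))) ->
  mixed_partial_exists (orthant q) js F /\
  forall y : 'rV[R]_q, orthant q y -> mixed_partial js F y =
    K0 * limn (series (fun n => density_coef q theta s n * partial_term a s js y n)).
Proof.
move=> a0 + FE; elim: js => [//|j js ih] /= /andP[jjs /ih[ex E]].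
have d (x : 'rV[R]_q) (ox : orthant q x) := is_derive_partial a0 jjs ox E.
split; first by split => // x ox; case: (d x ox).
by move=> x ox; case: (d x ox).
Qed.

(** Adding the missing term [m = 0], which is [a ^+ q * f x], gives a sum over all subsets, the
    shape of an expanded product. As [#|J| <= q], [inord] loses nothing in the grouping by
    cardinality. *)
Lemma gamma_operatorE q a (f : 'rV[R]_q -> R) (x : 'rV[R]_q) :
  gamma_operator a f x =
  \sum_(J : {set 'I_q}) a ^+ (q - #|J|) * mixed_partial (enum J) f x - a ^+ q * f x.
Proof.
rewrite (partition_big (fun J : {set 'I_q} => inord #|J| : 'I_q.+1) predT)//=.
have E (m : 'I_q.+1) :
    \sum_(J : {set 'I_q} | inord #|J| == m) a ^+ (q - #|J|) * mixed_partial (enum J) f x =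
    a ^+ (q - m) * \sum_(J : {set 'I_q} | #|J| == m) mixed_partial (enum J) f x.
  rewrite mulr_sumr; have h (J : {set 'I_q}) : (inord #|J| == m) = (#|J| == m).
    rewrite -val_eqE /= inordK// ltnS.
    by have := max_card (mem J); rewrite card_ord.
  under eq_bigl do rewrite h.
  by apply: eq_bigr => J /eqP ->.
under eq_bigr do rewrite E.
pose G (m : nat) := a ^+ (q - m) * \sum_(J : {set 'I_q} | #|J| == m) mixed_partial (enum J) f x.
have <- : \sum_(0 <= m < q.+1) G m = \sum_(m < q.+1) G m by rewrite big_mkord.
rewrite big_ltn// /G subn0 (big_pred1 finset.set0); last by move=> J; rewrite /= cards_eq0.
by rewrite enum_set0 /= addrAC subrr add0r.
Qed.

Lemma cvg_finite_sum (I : Type) (r : seq I) (u : I -> R^nat) (l : I -> R) :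
  (forall i, u i @ \oo --> l i) ->
  (fun n => \sum_(i <- r) u i n) @ \oo --> \sum_(i <- r) l i.
Proof.
move=> h; elim: r => [|i r ih].
  by rewrite big_nil; under eq_fun do rewrite big_nil; exact: cvg_cst.
rewrite big_cons; under eq_fun do rewrite big_cons.
by apply: cvgD.
Qed.

Lemma entire_coef_partial_term q theta a s (js : seq 'I_q) (x : 'rV[R]_q) :
  0 < a -> orthant q x ->
  entire_coef (fun n => density_coef q theta s n * partial_term a s js x n).
Proof.
move=> a0 ox; apply: entire_coefM; first exact: entire_coef_density.
apply: exp_growth_prod => i; apply: exp_growthM.
  by apply: exp_growth_density_factor => //; exact: ox.
by case: (i \in js); [exact: exp_growth_logderiv|exact: exp_growth_cst].
Qed.

(* The operator is [\prod_i (a + d/dx_i) - a ^+ q], expanded over the subsets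
   [J] of indices that are differentiated. *)
Lemma gamma_operator_density q theta a s (K0 : R) (F : 'rV[R]_q -> R)
    (x : 'rV[R]_q) : 0 < a -> orthant q x ->
  (forall y : 'rV[R]_q, orthant q y ->
    F y = K0 * limn (series (fun n => density_coef q theta s n * partial_term a s [::] y n))) ->
  gamma_operator a F x = K0 * limn (series (fun n => density_coef q theta s n *
    \prod_(i < q) (density_factor a s n (x ord0 i) * ((n%:R + s - 1) / x ord0 i)))) -
  a ^+ q * F x.
Proof.
move=> a0 ox FE; rewrite gamma_operatorE; congr (_ - _).
have MP (J : {set 'I_q}) : mixed_partial (enum J) F x =
    K0 * limn (series (fun n => density_coef q theta s n * partial_term a s (enum J) x n)).
  by have [_] := mixed_partial_density a0 (enum_uniq J) FE; exact.
under eq_bigr do rewrite MP mulrCA.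
rewrite -mulr_sumr; congr (_ * _); apply/esym/cvg_lim => //.
have -> : series (fun n => density_coef q theta s n *
    \prod_(i < q) (density_factor a s n (x ord0 i) * ((n%:R + s - 1) / x ord0 i))) =
  (fun K => \sum_(J : {set 'I_q}) (a ^+ (q - #|J|) *
    series (fun n => density_coef q theta s n * partial_term a s (enum J) x n) K)).
  apply/funext => K; rewrite /series /=; under [RHS]eq_bigr do rewrite mulr_sumr.
  rewrite exchange_big /=; apply: eq_bigr => n _.
  under [RHS]eq_bigr do rewrite mulrCA.
  rewrite -mulr_sumr; congr (_ * _).
  rewrite big_split /= /partial_term.
  have -> : \prod_(i < q) ((n%:R + s - 1) / x ord0 i) =
      \prod_(i < q) (density_logderiv a s n (x ord0 i) + a).
    by apply: eq_bigr => i _; rewrite /density_logderiv subrK.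
  rewrite bigA_distr /= mulr_sumr; apply: eq_bigr => J _.
  rewrite [in RHS]big_split /= mulrCA; congr (_ * _).
  under [in RHS]eq_bigr do rewrite mem_enum.
  have -> : a ^+ (q - #|J|) = \prod_(i < q) (if i \in J then 1 else a).
    rewrite (eq_bigr (fun i => if i \in ~: J then a else 1)); last first.
      by move=> i _; rewrite inE; case: (i \in J).
    by rewrite -big_mkcond /= prodr_const [#|~: J|]cardsCs finset.setCK card_ord.
  rewrite -big_split /=; apply: eq_bigr => i _.
  by case: ifP => _; rewrite ?mulr1 ?mul1r.
apply: cvg_finite_sum => J; apply: cvgM; first exact: cvg_cst.
exact: entire_coef_cvg1 (entire_coef_partial_term theta s (enum J) a0 ox).
Qed.

Lemma partial_term_nil q a s (x : 'rV[R]_q) n :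
  partial_term a s [::] x n = \prod_(i < q) density_factor a s n (x ord0 i).
Proof. by apply: eq_bigr => i _; rewrite in_nil mulr1. Qed.

Lemma density_coefS q theta s n :
  n.+1%:R * density_coef q theta (s - 1) n.+1 = theta * density_coef q theta s n.
Proof.
rewrite /density_coef; have -> : n.+1%:R + (s - 1) = n%:R + s by rewrite -natr1; ring.
rewrite factS natrM exprS; field.
by rewrite nat1r !pnatr_eq0 -lt0n fact_gt0.
Qed.

Lemma density_coefB1 q theta s n : (0 < q)%N ->
  density_coef q theta s n * (n%:R + s - 1) ^+ q =
  density_coef q theta (s - 1) n * (n%:R + (s - 1)).
Proof.
move=> q0; rewrite /density_coef addrA (rGammaD1 (n%:R + s - 1)) subrK.
move: (rGamma (n%:R + s)) => v; move: (n%:R + s - 1) => u.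
by case: q q0 => // p _; rewrite subn1 /= exprMn exprSr; ring.
Qed.

Lemma density_shift_identity q theta a s (x : 'rV[R]_q) : (0 < q)%N ->
  0 < a -> orthant q x ->
  limn (series (fun n => density_coef q theta s n *
    \prod_(i < q) (density_factor a s n (x ord0 i) * ((n%:R + s - 1) / x ord0 i)))) =
  a ^+ q * ((s - 1) * limn (series (fun n => density_coef q theta (s - 1) n *
      partial_term a (s - 1) [::] x n)) +
    theta * limn (series (fun n => density_coef q theta s n * partial_term a s [::] x n))).
Proof.
move=> q0 a0 ox; apply/cvg_lim => //.
pose v s n := density_coef q theta s n * partial_term a s [::] x n.
have cv s' : cvgn (series (v s')).
  by apply: entire_coef_cvg1; exact: entire_coef_partial_term.
(* The part with factor [n] loses its term [n = 0] and is reindexed, so its [K.+1] terms match [K]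
   terms of the series at [s]. *)
rewrite -cvg_shiftS.
have E n : density_coef q theta s n *
    \prod_(i < q) (density_factor a s n (x ord0 i) * ((n%:R + s - 1) / x ord0 i)) =
    a ^+ q * ((s - 1) * v (s - 1) n + n%:R * v (s - 1) n).
  have -> : \prod_(i < q) (density_factor a s n (x ord0 i) * ((n%:R + s - 1) / x ord0 i))
    = (n%:R + s - 1) ^+ q * (a ^+ q * partial_term a (s - 1) [::] x n).
    have C y : \prod_(i < q) y = y ^+ q by rewrite prodr_const card_ord.
    rewrite partial_term_nil -(C (n%:R + s - 1)) -(C a) -!big_split /=.
    apply: eq_bigr => i _; rewrite -(density_factor_div s n a0 (ox i)).
    by ring.
  by rewrite mulrA density_coefB1// /v; ring.
have -> : (fun K => series (fun n => density_coef q theta s n *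
    \prod_(i < q) (density_factor a s n (x ord0 i) * ((n%:R + s - 1) / x ord0 i))) K.+1) =
  (fun K => a ^+ q * ((s - 1) * series (v (s - 1)) K.+1 + theta * series (v s) K)).
  apply/funext => K; rewrite /series /=; under eq_bigr do rewrite E.
  rewrite -mulr_sumr big_split /= -mulr_sumr; congr (_ * (_ + _)).
  rewrite big_nat_recl//= mul0r add0r mulr_sumr; apply: eq_bigr => n _.
  rewrite /v mulrA density_coefS -mulrA; congr (_ * (_ * _)).
  by rewrite !partial_term_nil; apply: eq_bigr => i _; exact: density_factorS.
apply: cvgM; first exact: cvg_cst.
apply: cvgD; (apply: cvgM; first exact: cvg_cst); last exact: cv.
by rewrite cvg_shiftS; exact: cv.
Qed.

Lemma gamma_subordinator_densityE q lambda theta a (x : 'rV[R]_q) t :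
  gamma_subordinator_density lambda theta (fun=> a) x t =
  (1 - theta) `^ (lambda * t) * rGamma (lambda * t) *
  limn (series (fun n => density_coef q theta (lambda * t) n *
    partial_term a (lambda * t) [::] x n)).
Proof.
rewrite /gamma_subordinator_density.
have -> : (fun n => density_coef q theta (lambda * t) n *
    partial_term a (lambda * t) [::] x n) =
  (fun n => theta ^+ n / n`!%:R * rGamma (n%:R + lambda * t) ^+ (q - 1) *
    \prod_(i < q) ((a * x ord0 i) `^ (n%:R + lambda * t) / x ord0 i
                   * expR (- (a * x ord0 i)))); last by [].
by apply/funext => n; rewrite partial_term_nil.
Qed.

Lemma gamma_subordinator_density_pde q lambda theta a (x : 'rV[R]_q) t :
  (0 < q)%N -> lambda != 0 -> theta < 1 -> 0 < a -> orthant q x ->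
  let g := gamma_subordinator_density lambda theta (fun=> a) in
  gamma_operator a (g ^~ t) x =
  - (1 - theta) * a ^+ q * (g x t - g x (t - lambda^-1)).
Proof.
move=> q0 l0 t1 a0 ox g; rewrite /g; set s := lambda * t.
have FE (y : 'rV[R]_q) := gamma_subordinator_densityE lambda theta a y t.
rewrite (gamma_operator_density a0 ox (fun (y : 'rV[R]_q) _ => FE y)) -/s.
rewrite (density_shift_identity theta s q0 a0 ox) !gamma_subordinator_densityE.
have -> : lambda * (t - lambda^-1) = s - 1 by rewrite mulrBr mulfV.
have t10 : 0 < 1 - theta by rewrite subr_gt0.
have -> : (1 - theta) `^ s = (1 - theta) `^ (s - 1) * (1 - theta).
  by rewrite powRB1_gt0// divfK// gt_eqF.
(* The coefficient [s - 1] turns the prefactor [1/Gamma(s)] into [1/Gamma(s - 1)], also when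
   [s - 1 <= 0]: this is the density formula at time [t - 1/lambda]. *)
rewrite (rGammaD1 (s - 1)) subrK -/s.
by set D := limn _; set E := limn _; ring.
Qed.

Lemma gamma_subordinator_density_entire q lambda theta a (x : 'rV[R]_q) :
  theta < 1 -> 0 < a -> orthant q x ->
  exists N, entire_bound (gamma_subordinator_density lambda theta (fun=> a) x) N.
Proof.
move=> t1 a0 ox.
have ax i : 0 < a * x ord0 i by rewrite mulr_gt0//; exact: ox.
(* The product over [i] of the powers [(a x_i) ^ (lambda t)] is [expR (Lam * t)], the same for every
   [n]. The remaining dependence on [t] within a term lies in the reciprocal Gamma. *)
pose Lam := lambda * \sum_(i < q) ln (a * x ord0 i).
pose C n := \prod_(i < q) ((a * x ord0 i) ^+ n / x ord0 i * expR (- (a * x ord0 i))).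
have termE n t : density_coef q theta (lambda * t) n *
      partial_term a (lambda * t) [::] x n =
    (theta ^+ n / n`!%:R * C n) * (rGamma (n%:R + lambda * t) ^+ (q - 1) * expR (Lam * t)).
  rewrite partial_term_nil.
  have -> : \prod_(i < q) density_factor a (lambda * t) n (x ord0 i) = C n * expR (Lam * t).
    rewrite /Lam mulr_sumr mulr_suml expR_sum -big_split /=; apply: eq_bigr => i _.
    rewrite /density_factor powRD_gt0// powR_mulrn ?(ltW (ax i))//.
    rewrite {1}/powR gt_eqF// (mulrAC lambda); ring.
  by rewrite /density_coef; ring.
pose N n r : R := `|theta ^+ n / n`!%:R * C n| *
  ((rGamma_cst (`|lambda| * r) * rGamma_base (`|lambda| * r) ^+ n) ^+ (q - 1) *
   expR (`|Lam| * r)).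
have ht n : entire_bound (fun t => density_coef q theta (lambda * t) n *
    partial_term a (lambda * t) [::] x n) (N n).
  have h := entire_boundZ (theta ^+ n / n`!%:R * C n)
    (entire_boundM (entire_boundX (q - 1) (entire_bound_scale lambda (rGamma_bound n)))
      (entire_bound_expR Lam)).
  by apply: entire_bound_ext h _ => t; rewrite termE.
(* For each fixed [r], the norms are [1/n!] times a sequence of exponential growth, up to absolute
   values; the bound on their sums may depend on [r] in any way. *)
have /choice[M hM] : forall r, exists B : R, 0 <= r -> forall m : nat, series (N ^~ r) m <= B.
  move=> r.
  have gC : exp_growth C.
    apply: exp_growth_prod => i.
    apply: exp_growthM; last exact: exp_growth_cst.
    by apply: exp_growthM; [exact: exp_growthX|exact: exp_growth_cst].
  have gB : exp_growth (fun n => (rGamma_cst (`|lambda| * r) *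
      rGamma_base (`|lambda| * r) ^+ n) ^+ (q - 1) * expR (`|Lam| * r)).
    apply: exp_growthM; last exact: exp_growth_cst.
    apply: exp_growth_expn; apply: exp_growthM; first exact: exp_growth_cst.
    exact: exp_growthX.
  have [B hB] := entire_coefM entire_coef_invfact
     (exp_growthM (exp_growthX theta) (exp_growthM gC gB)).
  exists (B 1) => r0 m; apply: le_trans (hB 1 m ler01); apply: ler_sum => n _.
  rewrite expr1n mulr1 /N; set b := (_ * expR (`|Lam| * r)).
  have -> : n`!%:R^-1 * (theta ^+ n * (C n * b)) = theta ^+ n / n`!%:R * C n * b by ring.
  by rewrite [leRHS]normrM ler_wpM2l// ler_norm.
have h1 := entire_bound_lim ht (fun r (m : nat) r0 => hM r r0 m).
have h2 := entire_boundM (entire_bound_scale lambda (rGamma_bound 0)) h1.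
have h3 := entire_boundM (entire_bound_expR (lambda * ln (1 - theta))) h2.
eexists; apply: entire_bound_ext h3 _ => t.
rewrite gamma_subordinator_densityE add0r.
have -> : expR (lambda * ln (1 - theta) * t) = (1 - theta) `^ (lambda * t).
  by rewrite /powR gt_eqF ?subr_gt0// mulrAC.
by rewrite mulrA.
Qed.

End differential_equation.

(** * Decay at infinity *)

Section behaviour_at_infinity.
Context {R : realType}.
Implicit Types (a b s t theta lambda : R).

Lemma natr_expRN_le b n : 0 < b -> n%:R * expR (- b) ^+ n <= b^-1.
Proof.
move=> b0; rewrite -expRM_natl mulrN expRN ler_pdivrMr ?expR_gt0//.
rewrite ler_pdivlMl//; apply: le_trans (expR_ge1Dx _).
by rewrite mulrC lerDr.
Qed.

(** [s (s+1) ... (s+n-1)] is at least [s] times the factorial of [n - 1]. The missing factor [n]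
    costs an exponential of arbitrarily small rate [b]. The two summands of the constant serve
    [n = 0] and [n > 0]. *)
Lemma rGamma_fact_bound s b : 0 < s -> 0 < b -> exists2 C : R, 0 <= C &
  forall n, rGamma (n%:R + s) <= C * expR b ^+ n / n`!%:R.
Proof.
move=> s0 b0; have r0 := rGamma_gt0 s0.
exists (rGamma s + rGamma s / s * b^-1).
  apply: addr_ge0; first exact: ltW.
  by apply: mulr_ge0; [exact: divr_ge0 (ltW r0) (ltW s0)|rewrite invr_ge0 ltW].
case=> [|n].
  rewrite add0r expr0 fact0 divr1 mulr1 lerDl.
  by apply: mulr_ge0; [exact: divr_ge0 (ltW r0) (ltW s0)|rewrite invr_ge0 ltW].
have f0 : (0 : R) < n`!%:R by rewrite ltr0n fact_gt0.
have p0 : 0 < s * n`!%:R by rewrite mulr_gt0.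
have P : s * n`!%:R <= \prod_(i < n.+1) (s + i%:R).
  rewrite big_ord_recl /= addr0 ler_wpM2l ?(ltW s0)//.
  elim: n {f0 p0} => [|n ih]; first by rewrite big_ord0.
  rewrite big_ord_recr /= factS mulnC natrM; apply: ler_pM => //.
  by rewrite /bump /= add1n lerDr ltW.
have h : rGamma (n.+1%:R + s) <= rGamma s / (s * n`!%:R).
  rewrite ler_pdivlMr// (rGamma_natD s n.+1) mulrC (addrC s).
  by rewrite ler_pM2r// rGamma_gt0 ?addr_gt0.
apply: le_trans h _.
rewrite factS natrM; set E := expR b ^+ n.+1.
have E0 : 0 < E by rewrite exprn_gt0 ?expR_gt0.
have nE : n.+1%:R <= b^-1 * E.
  have := natr_expRN_le n.+1 b0; rewrite expRN exprVn ler_pdivrMr//.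
have n0 : (0 : R) < n.+1%:R by rewrite ltr0n.
have -> : (rGamma s + rGamma s / s * b^-1) * E / (n.+1%:R * n`!%:R) =
   rGamma s * E / (n.+1%:R * n`!%:R) + rGamma s / (s * n`!%:R) * (b^-1 * E / n.+1%:R).
  by field; rewrite !gt_eqF.
apply: ler_wpDl.
  exact: divr_ge0 (mulr_ge0 (ltW r0) (ltW E0)) (mulr_ge0 (ltW n0) (ltW f0)).
apply: ler_peMr; first exact: divr_ge0 (ltW r0) (ltW p0).
by rewrite ler_pdivlMr ?mul1r.
Qed.

Lemma exprn_fact_le_expR (y : R) n : 0 <= y -> y ^+ n / n`!%:R <= expR y.
Proof.
move=> y0; case: n => [|n].
  by rewrite expr0 fact0 divr1; apply: le_trans (expR_ge1Dx y); rewrite lerDl.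
by apply: le_trans (expR_ge1Dxn n y0); rewrite lerDr.
Qed.

Lemma geometric_sum_le (b : R) K : 0 <= b -> b < 1 ->
  \sum_(0 <= n < K) b ^+ n <= (1 - b)^-1.
Proof.
move=> b0 b1; have c0 : 0 < 1 - b by rewrite subr_gt0.
rewrite -(ler_pM2l c0) mulfV ?gt_eqF// big_mkord.
by rewrite -opprB mulNr -subrX1 opprB gerBl exprn_ge0.
Qed.

Lemma density_exp_bound q theta a s : (0 < q)%N -> 0 < theta < 1 -> 0 < a -> 0 < s ->
  exists C c : R, [/\ 0 <= C, 0 < c & forall x : 'rV[R]_q, orthant q x ->
   `|limn (series (fun n => density_coef q theta s n * partial_term a s [::] x n))| <=
   C * \prod_(i < q) ((a * x ord0 i) `^ s / x ord0 i * expR (- (c * x ord0 i)))].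
Proof.
move=> q0 /andP[t0 t1] a0 s0.
(* With [theta = be ^+ (2 * q)], the [q - 1] factors [be ^- n] lost in bounding
   [rGamma (n%:R + s)] by [n`!%:R^-1] leave [be ^+ n] for each of the [q]
   exponential series and one more [be ^+ n] for summability. *)
pose b := - ln theta / (2 * q%:R).
have qR : (0 : R) < q%:R by rewrite ltr0n.
have b0 : 0 < b.
  by rewrite divr_gt0 ?mulr_gt0// oppr_gt0 ln_lt0// t0.
pose be := expR (- b).
have be0 : 0 < be by exact: expR_gt0.
have be1 : be < 1 by rewrite expR_lt1 oppr_lt0.
have tE : theta = be ^+ (2 * q).
  rewrite /be -expRM_natl natrM /b -[LHS]lnK ?posrE//; congr expR.
  by field; rewrite gt_eqF.
have [C0 C00 hC] := rGamma_fact_bound s0 b0.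
pose C := C0 ^+ (q - 1).
have CC0 : 0 <= C by rewrite exprn_ge0.
have coefE n : density_coef q theta s n <= C * be ^+ n * (be ^+ n / n`!%:R) ^+ q.
  have f0 : (0 : R) < n`!%:R by rewrite ltr0n fact_gt0.
  rewrite /density_coef.
  apply: (@le_trans _ _ (theta ^+ n / n`!%:R * (C0 * expR b ^+ n / n`!%:R) ^+ (q - 1))).
    rewrite ler_wpM2l//.
      by rewrite mulr_ge0 ?exprn_ge0 ?invr_ge0// ltW.
    rewrite lerXn2r ?nnegrE//; first by rewrite ltW// rGamma_gt0// ltr_wpDl.
    by rewrite !mulr_ge0 ?exprn_ge0 ?invr_ge0 ?expR_ge0.
  rewrite le_eqVlt; apply/orP; left; apply/eqP.
  have bV : expR b = be^-1 by rewrite /be expRN invrK.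
  rewrite tE bV /C; case: (q) q0 => // p _; rewrite subn1 /=.
  have -> : (be ^+ (2 * p.+1)) ^+ n = be ^+ n * be ^+ n * (be ^+ n) ^+ p * (be ^+ n) ^+ p.
    rewrite -!exprM -!exprD; congr (_ ^+ _); lia.
  rewrite exprS !exprMn !exprVn.
  have : be ^+ n != 0 by rewrite gt_eqF// exprn_gt0.
  have : n`!%:R != 0 :> R by rewrite gt_eqF.
  move: (be ^+ n) (n`!%:R : R) => B f fz Bz.
  have : B ^+ p != 0 by rewrite expf_neq0.
  have : f ^+ p != 0 by rewrite expf_neq0.
  move: (B ^+ p) (f ^+ p) (C0 ^+ p) => B' f' C' f'z B'z; field.
  by rewrite fz f'z B'z.
(* The geometric series gives [1 / (1 - be)]. Each exponential series costs [expR (be * (a * x_i))],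
   so that [expR (- (a * x_i))] keeps the rate [(1 - be) * a]. *)
exists (C / (1 - be)), ((1 - be) * a).
have c0 : 0 < 1 - be by rewrite subr_gt0.
split; [by rewrite divr_ge0// ltW | by rewrite mulr_gt0 |] => x ox.
have ax i : 0 < a * x ord0 i by rewrite mulr_gt0//; exact: ox.
set Y := \prod_(i < q) _.
have Y0 : 0 <= Y.
  apply: prodr_ge0 => i _; rewrite !mulr_ge0 ?powR_ge0 ?expR_ge0 ?invr_ge0//.
  by apply: ltW; exact: ox.
have termle n : `|density_coef q theta s n * partial_term a s [::] x n| <=
    C * be ^+ n * Y.
  have p0 : 0 <= partial_term a s [::] x n.
    rewrite partial_term_nil; apply: prodr_ge0 => i _.
    rewrite !mulr_ge0 ?powR_ge0 ?expR_ge0 ?invr_ge0//.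
    by apply: ltW; exact: ox.
  have d0 : 0 <= density_coef q theta s n.
    apply: mulr_ge0; last by apply/exprn_ge0/ltW/rGamma_gt0; exact: ltr_wpDl.
    by apply: mulr_ge0; [exact: exprn_ge0 (ltW t0)|rewrite invr_ge0].
  rewrite (ger0_norm (mulr_ge0 d0 p0)).
  apply: le_trans (ler_wpM2r p0 (coefE n)) _.
  rewrite -[leLHS]mulrA; apply: ler_wpM2l.
    by apply: mulr_ge0 => //; exact: exprn_ge0 (ltW be0).
  have CE (y : R) : \prod_(i < q) y = y ^+ q by rewrite prodr_const card_ord.
  rewrite partial_term_nil /Y -CE -big_split /=.
  apply: ler_prod => i _; apply/andP; split.
    by rewrite !mulr_ge0 ?exprn_ge0 ?powR_ge0 ?expR_ge0 ?invr_ge0 ?(ltW (ox i)) ?(ltW be0).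
  rewrite (density_factor0 s n a0 (ox i)) /density_factor add0r.
  have E0 : 0 <= (a * x ord0 i) `^ s / x ord0 i * expR (- (a * x ord0 i)).
    by rewrite !mulr_ge0 ?powR_ge0 ?expR_ge0 ?invr_ge0 ?(ltW (ox i)).
  have z0 : 0 <= be * (a * x ord0 i) by rewrite mulr_ge0 ?(ltW (ax i)) ?(ltW be0).
  have -> : be ^+ n / n`!%:R * ((a * x ord0 i) ^+ n *
      ((a * x ord0 i) `^ s / x ord0 i * expR (- (a * x ord0 i)))) =
      (be * (a * x ord0 i)) ^+ n / n`!%:R *
      ((a * x ord0 i) `^ s / x ord0 i * expR (- (a * x ord0 i))).
    have -> : (be * (a * x ord0 i)) ^+ n = be ^+ n * (a * x ord0 i) ^+ n.
      exact: exprMn.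
    move: (_ / _ * expR _) => Z; ring.
  apply: le_trans (ler_wpM2r E0 (exprn_fact_le_expR n z0)) _.
  have -> : expR (- ((1 - be) * a * x ord0 i)) =
      expR (be * (a * x ord0 i)) * expR (- (a * x ord0 i)).
    by rewrite -expRD; congr expR; ring.
  by rewrite mulrCA.
have cv := entire_coef_cvg1 (entire_coef_partial_term theta s [::] a0 ox).
apply: (cvg_le_bound (cvg_norm cv)) => K.
apply: le_trans (ler_norm_sum _ _ _) _.
apply: (@le_trans _ _ (\sum_(0 <= n < K) C * be ^+ n * Y)).
  by apply: ler_sum => n _; exact: termle.
rewrite -mulr_suml -mulr_sumr ler_wpM2r// ler_wpM2l//.
exact: geometric_sum_le (ltW be0) be1.
Qed.

(** For [y >= 1/de] the exponential wins whatever the sign of [r]. Below [1/de], a negative power is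
    bounded only away from 0; the alternative in the boundary condition originates here. *)
Lemma powR_le_expRM (r de : R) (D : set R) : 0 < de -> (forall y, D y -> 0 < y) ->
  0 <= r \/ (exists2 e, 0 < e & forall y, D y -> e <= y) ->
  exists2 C : R, 0 <= C & forall y, D y -> y `^ r <= C * expR (de * y).
Proof.
move=> de0 D0 h.
have [E [E0 hE]] : exists E : R, 0 <= E /\ forall y, D y -> y < de^-1 -> y `^ r <= E.
  have [r0|r0] := leP 0 r.
    exists (de^-1 `^ r); split => [|y Dy yd]; first exact: powR_ge0.
    by apply: ge0_ler_powR; rewrite ?nnegrE ?invr_ge0 ?(ltW de0) ?(ltW yd) ?(ltW (D0 _ Dy)).
  case: h => [|[e e0 he]]; first by rewrite leNgt r0.
  exists (e `^ r); split => [|y Dy _]; first exact: powR_ge0.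
  rewrite -[r]opprK !(powRN _ (- r)) lef_pV2 ?posrE ?powR_gt0 ?(D0 _ Dy)//.
  by apply: ge0_ler_powR; rewrite ?nnegrE ?oppr_ge0 ?(ltW e0) ?(ltW r0) ?(ltW (D0 _ Dy)) ?he.
have [C1 [C10 hC1]] := powR_expRN_le r.
have dr0 : 0 <= de^-1 `^ r by exact: powR_ge0.
exists (de^-1 `^ r * C1 + E) => [|y Dy]; first by rewrite addr_ge0 ?mulr_ge0.
have y0 := D0 _ Dy; have dy0 : 0 < de * y by rewrite mulr_gt0.
rewrite mulrDl; have [yd|yd] := ltP y de^-1.
  apply: le_trans (hE _ Dy yd) _.
  apply: ler_wpDl; first by rewrite !mulr_ge0 ?expR_ge0.
  by rewrite ler_peMr// -expR0 ler_expR ltW.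
apply: ler_wpDr; first by rewrite mulr_ge0 ?expR_ge0.
have z1 : 1 <= de * y by rewrite mulrC -ler_pdivrMr// mul1r.
have {1}-> : y = de^-1 * (de * y) by rewrite mulKf// gt_eqF.
rewrite powRM ?invr_ge0 ?(ltW de0) ?(ltW dy0)// -mulrA ler_wpM2l//.
have := hC1 _ z1; rewrite expRN ler_pdivrMr ?expR_gt0// => /le_trans; apply.
rewrite ler_wpM2r ?expR_ge0// ler_pdivrMr// ler_peMr//.
Qed.

Lemma euclidean_norm_le_sum q (x : 'rV[R]_q) : orthant q x ->
  euclidean_norm x <= \sum_(i < q) x ord0 i.
Proof.
move=> ox; have S0 : 0 <= \sum_(i < q) x ord0 i.
  by apply: sumr_ge0 => i _; exact/ltW/ox.
rewrite /euclidean_norm -[leRHS]ger0_norm// -sqrtr_sqr ler_wsqrtr// expr2 mulr_suml.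
apply: ler_sum => i _; rewrite expr2 ler_wpM2l ?(ltW (ox i))//.
rewrite (bigD1 i)//= lerDl; apply: sumr_ge0 => j _; exact/ltW/ox.
Qed.

(** Half of the exponential rate pays for the powers [x_i ^ (s - 1)]; the other half gives decay in
    the sum of the coordinates, which dominates the norm on the orthant. *)
Lemma gamma_subordinator_density_vanishes q lambda theta a t (D : set 'rV[R]_q) :
  (0 < q)%N -> 0 < lambda -> 0 < theta < 1 -> 0 < a -> 0 <= t ->
  D `<=` orthant q ->
  [\/ t = 0, 1 <= lambda * t | exists2 e, 0 < e & D `<=` inner_orthant q e] ->
  vanishes_at_infinity D
    (fun x => gamma_subordinator_density lambda theta (fun=> a) x t).
Proof.
move=> q0 l0 t01 a0 t0 Do hD eps eps0.
(* At [t = 0] the formula vanishes identically because [1/Gamma(0) = 0]; the mass sits at the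
   origin, outside the open orthant. *)
have [tz|tz] := eqVneq t 0.
  exists 0 => x _ _; rewrite gamma_subordinator_densityE tz mulr0 rGamma0.
  by rewrite mulr0 mul0r normr0.
have {}t0 : 0 < t by rewrite lt_neqAle eq_sym tz.
set s := lambda * t; have s0 : 0 < s by rewrite mulr_gt0.
have [C [c [C0 c0 hC]]] := density_exp_bound q0 t01 a0 s0.
pose de := c / 2; have de0 : 0 < de by rewrite divr_gt0.
have deE : c = de + de by rewrite /de; field.
clearbody de.
have [C2 C20 hC2] : exists2 C2 : R, 0 <= C2 &
    forall x : 'rV[R]_q, D x -> forall i, x ord0 i `^ (s - 1) <= C2 * expR (de * x ord0 i).
  have [||C2 C20 hC2] := @powR_le_expRM (s - 1) de
     [set y | exists2 x, D x & exists i, y = x ord0 i] de0.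
  - by move=> y [x Dx [i ->]]; exact: Do.
  - case: hD => [/eqP|s1|[e e0 he]]; first by rewrite (negbTE tz).
      by left; rewrite subr_ge0.
    by right; exists e => // y [x Dx [i ->]]; exact: he.
  by exists C2 => // x Dx i; apply: hC2; exists x => //; exists i.
pose K0 := `|(1 - theta) `^ s * rGamma s|.
pose A := a `^ s * C2.
have A0 : 0 <= A by rewrite mulr_ge0 ?powR_ge0.
pose K := K0 * (C * A ^+ q) + 1.
have K1 : 0 < K.
  apply: ltr_wpDl => //; apply: mulr_ge0; first exact: normr_ge0.
  by apply: mulr_ge0 => //; exact: exprn_ge0.
(* The radius at which [de * S * eps] exceeds [K]; then [K * expR (- (de * S)) < eps], since
   [v <= expR v]. *)
exists (K / (de * eps)) => x Dx xM; have ox := Do _ Dx.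
set S := \sum_(i < q) x ord0 i.
have SM : K / (de * eps) < S by apply: lt_le_trans xM _; exact: euclidean_norm_le_sum.
rewrite gamma_subordinator_densityE normrM -/K0.
apply: (@le_lt_trans _ _ (K * expR (- (de * S)))).
  apply: (@le_trans _ _ (K0 * (C * A ^+ q) * expR (- (de * S)))); last first.
    by rewrite ler_wpM2r ?expR_ge0// /K lerDl.
  rewrite -[leRHS]mulrA; apply: ler_wpM2l; first exact: normr_ge0.
  apply: le_trans (hC _ ox) _; rewrite -[leRHS]mulrA; apply: ler_wpM2l => //.
  have CE (y : R) : \prod_(i < q) y = y ^+ q by rewrite prodr_const card_ord.
  rewrite -CE /S mulr_sumr -sumrN expR_sum -big_split /=.
  apply: ler_prod => i _; apply/andP; split.
    by rewrite !mulr_ge0 ?powR_ge0 ?expR_ge0 ?invr_ge0 ?(ltW (ox i)).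
  rewrite powRM ?(ltW a0) ?(ltW (ox i))// -(mulrA (a `^ s)) -powRB1_gt0; last exact: ox.
  rewrite /A -!mulrA ler_wpM2l ?powR_ge0//.
  apply: le_trans (ler_wpM2r (expR_ge0 _) (hC2 _ Dx i)) _.
  rewrite -[leLHS]mulrA -expRD.
  have -> : de * x ord0 i + - (c * x ord0 i) = - (de * x ord0 i) by rewrite deE; ring.
  by [].
rewrite expRN ltr_pdivrMr ?expR_gt0//.
rewrite ltr_pdivrMr ?mulr_gt0// in SM; apply: lt_le_trans SM _.
rewrite mulrA (mulrC _ eps) ler_wpM2l ?(ltW eps0)//.
by apply: le_trans (expR_ge1Dx _); rewrite mulrC lerDr.
Qed.

End behaviour_at_infinity.

(** * Lebesgue measure on tuples *)

Section sigma_finite_measure_of.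
Context d (T : measurableType d) (R : realType) (m : {measure set T -> \bar R}).
Hypothesis m_sigma_finite : sigma_finite setT m.

(** A new name for [m], which can carry the sigma-finite structure when sigma-finiteness is a
    hypothesis. Tonelli's theorem requires this for the measures built by induction on the
    dimension. *)
Definition measure_fun : set T -> \bar R := m.

HB.instance Definition _ := Measure.on measure_fun.
HB.instance Definition _ :=
  Measure_isSigmaFinite.Build _ _ _ measure_fun m_sigma_finite.

Definition sigma_finite_measure_of : {sigma_finite_measure set T -> \bar R} :=
  measure_fun.

End sigma_finite_measure_of.

Section lebesgue_on_tuples.
Context {R : realType}.
Local Open Scope ereal_scope.
Notation mu := (@lebesgue_measure R).

Definition cons_pair n (p : R * n.-tuple R) : n.+1.-tuple R := [tuple of p.1 :: p.2].

Definition uncons_pair n (v : n.+1.-tuple R) : R * n.-tuple R :=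
  (tnth v ord0, [tuple of behead v]).

Lemma uncons_pairK n : cancel (@cons_pair n) (@uncons_pair n).
Proof. by case=> x v; congr pair; apply/val_inj. Qed.

Lemma measurable_cons_pair n : measurable_fun [set: R * n.-tuple R] (@cons_pair n).
Proof. by apply: measurable_cons; [exact: measurable_fst|exact: measurable_snd]. Qed.

Lemma measurable_uncons_pair n : measurable_fun [set: n.+1.-tuple R] (@uncons_pair n).
Proof.
by apply: measurable_fun_pair; [exact: measurable_tnth|exact: measurable_behead].
Qed.

Lemma measurable_cons_section n (f : n.+1.-tuple R -> \bar R) (x : R) :
  measurable_fun setT f -> measurable_fun setT (fun v : n.-tuple R => f [tuple of x :: v]).
Proof.
move=> mf; apply: (measurableT_comp mf).
by apply: measurable_cons.
Qed.

(** An iterated integral is not visibly additive or monotone continuous. Representing it by a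
    measure makes it so on nonnegative measurable functions. The measure is the image of a product
    measure, and its sigma-finiteness is carried along for Tonelli in the next dimension. *)
Lemma exists_tuple_measure n : exists L : {sigma_finite_measure set (n.-tuple R) -> \bar R},
  forall f : n.-tuple R -> \bar R, measurable_fun setT f -> (forall v, 0 <= f v) ->
  \int[L]_v f v = tuple_integral f.
Proof.
elim: n => [|n [L hL]].
  exists (\d_([tuple] : 0.-tuple R)) => f mf f0.
  by rewrite integral_dirac//= diracT mul1e.
pose m := (mu \x L)%E.
pose L1 := measure_function_pushforward__canonical__measure_function_Measure m
  (measurable_cons_pair (n := n)).
have sf : sigma_finite setT L1.
  have /sigma_finiteP[F [TF ndF Foo]] := sigma_finiteT mu.
  have /sigma_finiteP[G [TG ndG Goo]] := sigma_finiteT L.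
  (* Both exhaustions are nondecreasing, so the diagonal rectangles [F k] times [G k] already cover
     the product. *)
  exists (fun k => @uncons_pair n @^-1` (F k `*` G k)).
    apply/seteqP; split => // v _.
    have [k _ Fk] : (\bigcup_k F k) (uncons_pair v).1 by rewrite -TF.
    have [l _ Gl] : (\bigcup_k G k) (uncons_pair v).2 by rewrite -TG.
    exists (maxn k l) => //; split.
      by move: Fk; exact/subsetPset/ndF/leq_maxl.
    by move: Gl; exact/subsetPset/ndG/leq_maxr.
  move=> k; have [mF oF] := Foo k; have [mG oG] := Goo k; split.
    by rewrite -[X in measurable X]setTI; apply: measurable_uncons_pair => //; exact: measurableX.
  rewrite /L1 /= /pushforward -comp_preimage.
  rewrite (_ : _ \o _ = id); last by apply/funext => p /=; exact: uncons_pairK.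
  by rewrite /m product_measure1E// lte_mul_pinfty// ge0_fin_numE.
pose L2 := sigma_finite_measure_of sf.
exists L2 => f mf f0.
have -> : \int[L2]_v f v = \int[m]_p f (cons_pair p).
  rewrite /L2 /= /L1 ge0_integral_pushforward//; exact: measurable_cons_pair.
rewrite /m fubini_tonelli1//; last first.
  by apply: (measurableT_comp mf); exact: measurable_cons_pair.
rewrite /fubini_F /=; apply: eq_integral => x _.
rewrite -hL//.
exact: measurable_cons_section.
Qed.

Lemma tuple_integral_ge0 n (f : n.-tuple R -> \bar R) :
  measurable_fun setT f -> (forall v, 0 <= f v) -> 0 <= tuple_integral f.
Proof.
have [L hL] := exists_tuple_measure n.
by move=> mf f0; rewrite -hL//; apply: integral_ge0.
Qed.

Lemma tuple_integralZl n (k : R) (f : n.-tuple R -> \bar R) : (0 <= k)%R ->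
  measurable_fun setT f -> (forall v, 0 <= f v) ->
  tuple_integral (fun v => k%:E * f v) = k%:E * tuple_integral f.
Proof.
have [L hL] := exists_tuple_measure n.
move=> k0 mf f0; rewrite -!hL//.
- by rewrite ge0_integralZl.
- exact: measurable_funeM.
- by move=> v; rewrite mule_ge0.
Qed.

Lemma tuple_integral_nneseries n (f : nat -> n.-tuple R -> \bar R) :
  (forall k, measurable_fun setT (f k)) -> (forall k v, 0 <= f k v) ->
  tuple_integral (fun v => \sum_(k <oo) f k v) = \sum_(k <oo) tuple_integral (f k).
Proof.
have [L hL] := exists_tuple_measure n.
move=> mf f0; rewrite -hL//.
- rewrite integral_nneseries//; apply: eq_eseriesr => k _; exact: hL.
- exact: ge0_emeasurable_sum.
- by move=> v; apply: nneseries_ge0 => k _ _.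
Qed.

Lemma measurable_prod_tnth n (f : 'I_n -> R -> R) :
  (forall i, measurable_fun setT (f i)) ->
  measurable_fun [set: n.-tuple R] (fun v => \prod_(i < n) f i (tnth v i))%R.
Proof.
move=> mf; apply: measurable_prod => i _.
by apply: measurableT_comp => //; exact: measurable_tnth.
Qed.

Lemma tuple_integral_prod n (f : 'I_n -> R -> R) :
  (forall i, measurable_fun setT (f i)) -> (forall i x, (0 <= f i x)%R) ->
  tuple_integral (fun v => (\prod_(i < n) f i (tnth v i))%R%:E) =
  \prod_(i < n) \int[mu]_x (f i x)%:E.
Proof.
elim: n f => [|n ih] f mf f0; first by rewrite /= !big_ord0.
rewrite big_ord_recl -ih//= -ge0_integralZr//; last first.
- apply: tuple_integral_ge0.
    by apply/measurable_EFinP; exact: (measurable_prod_tnth (fun i => mf (lift ord0 i))).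
  by move=> v; rewrite lee_fin; apply: prodr_ge0 => i _.
- by move=> x _; rewrite lee_fin.
- by apply/measurable_EFinP; exact: mf.
apply: eq_integral => x _; rewrite -tuple_integralZl//.
- congr tuple_integral; apply/funext => v; rewrite big_ord_recl EFinM.
  by congr (_ * (_)%:E); apply: eq_bigr => i _; rewrite tnthS.
- by apply/measurable_EFinP; exact: (measurable_prod_tnth (fun i => mf (lift ord0 i))).
- by move=> v; rewrite lee_fin; apply: prodr_ge0 => i _.
Qed.

Definition tuple_rect n (A : 'I_n -> set R) : set (n.-tuple R) :=
  [set v | forall i, A i (tnth v i)].

Lemma measurable_tuple_rect n (A : 'I_n -> set R) :
  (forall i, measurable (A i)) -> measurable (tuple_rect A).
Proof.
move=> mA.
have -> : tuple_rect A = \bigcap_(i in [set: 'I_n]) ((fun v => tnth v i) @^-1` A i).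
  by apply/seteqP; split => [v h i _|v h i]; [exact: h|exact: (h i I)].
apply: fin_bigcap_measurable => // i _.
by rewrite -[X in measurable X]setTI; exact: measurable_tnth.
Qed.

(** Rectangles are stable under intersection and generate the product sigma-algebra, since the
    preimage of a set by one coordinate is a rectangle whose other sides are full. As [m1] is
    finite, the constant sequence [setT] serves as exhaustion. *)
Lemma measure_tuple_unique n (m1 m2 : {measure set (n.-tuple R) -> \bar R}) :
  m1 setT < +oo ->
  (forall A : 'I_n -> set R, (forall i, measurable (A i)) ->
    m1 (tuple_rect A) = m2 (tuple_rect A)) ->
  forall A, measurable A -> m1 A = m2 A.
Proof.
move=> m1T m12 A mA.
pose G := [set tuple_rect A | A in [set A : 'I_n -> set R | forall i, measurable (A i)]].
have rectT : G setT.
  by exists (fun=> setT) => //; apply/seteqP.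
apply: (measure_unique G (fun=> setT)) => //.
- apply/seteqP; split.
    apply: smallest_sub; first exact: smallest_sigma_algebra.
    rewrite -bigcup_seq => B [i _ [C mC <-]]; apply: sub_sigma_algebra.
    exists (fun j => if j == i then C else setT) => [j|].
      by case: ifP.
    apply/seteqP; split => [v /(_ i)|v [_ Cv] j] /=; first by rewrite eqxx; split.
    by case: eqP => [->|].
  apply: smallest_sub; first exact: sigma_algebra_measurable.
  by move=> _ [B mB <-]; exact: measurable_tuple_rect.
- move=> _ _ [B mB <-] [C mC <-].
  exists (fun i => B i `&` C i) => [i|]; first exact: measurableI.
  apply/seteqP; split => [v h|v [h1 h2] i]; last by split; [exact: h1|exact: h2].
  by split => i; have [] := h i.
- by apply/seteqP; split => // v _; exists 0%N.
- by move=> _ [B mB <-]; exact: m12.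
Qed.

End lebesgue_on_tuples.

(** * Measures given by a density *)

Section measure_with_density.
Local Open Scope ereal_scope.
Context d (T : measurableType d) (R : realType) (nu : {measure set T -> \bar R}).
Variable f : T -> \bar R.
Hypotheses (mf : measurable_fun setT f) (f0 : forall x, 0 <= f x).

Definition density_measure (A : set T) := \int[nu]_(x in A) f x.

Let density_measure0 : density_measure set0 = 0.
Proof. exact: integral_set0. Qed.

Let density_measure_ge0 A : 0 <= density_measure A.
Proof. by apply: integral_ge0. Qed.

Let density_measure_sigma_additive : semi_sigma_additive density_measure.
Proof.
move=> F mF tF mUF; rewrite {2}/density_measure ge0_integral_bigcup//.
  by apply: is_cvg_nneseries => n _ _; exact: density_measure_ge0.
exact: measurable_funTS.
Qed.

HB.instance Definition _ := isMeasure.Build _ _ _ density_measure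
  density_measure0 density_measure_ge0 density_measure_sigma_additive.

Definition measure_of_density : {measure set T -> \bar R} := density_measure.

End measure_with_density.

(** * Law of the subordinator *)

Section gamma_subordinator_law.
Context d (T : measurableType d) (R : realType) (P : probability T R).
Implicit Types (a s t lambda theta : R).
Notation mu := (@lebesgue_measure R).

Lemma prode_option q (F : option 'I_q -> \bar R) :
  (\prod_(o : option 'I_q) F o = F None * \prod_(i < q) F (Some i))%E.
Proof.
rewrite (bigD1 None)//=; congr (_ * _)%E.
rewrite (reindex_omap Some id) /=; last by case.
by apply: eq_bigl => i; rewrite eqxx.
Qed.

(** The event [E] is intersected rather than conditioned on, which avoids dividing by [P E]. Both
    sides are measures in [A], the first of them finite, and they agree on rectangles by
    independence and Tonelli. *)
Lemma independent_density_law q (X : 'I_q -> T -> R) (f : 'I_q -> R -> R) (E : set T) :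
  measurable E -> (forall i, measurable_fun setT (X i)) ->
  (forall i, measurable_fun setT (f i)) -> (forall i x, 0 <= f i x) ->
  (forall i A, measurable A -> P (X i @^-1` A) = \int[mu]_(x in A) (f i x)%:E)%E ->
  (forall A : 'I_q -> set R, (forall i, measurable (A i)) ->
    P (E `&` [set w | forall i, A i (X i w)]) =
    P E * \prod_(i < q) P (X i @^-1` A i))%E ->
  forall A : set (q.-tuple R), measurable A ->
  P (E `&` [set w | A [tuple X i w | i < q]]) =
  tuple_integral (fun v =>
    (fine (P E) * \prod_(i < q) f i (tnth v i) * \1_A v)%:E).
Proof.
move=> mE mX mf f0 fX ind A mA.
have mV : measurable_fun setT (fun w => [tuple X i w | i < q]).
  apply/measurable_fun_tnthP => i.
  by rewrite (_ : _ \o _ = X i)//; apply/funext => w /=; rewrite tnth_mktuple.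
pose m1 := measure_function_pushforward__canonical__measure_function_Measure
  (measure_function_mrestr__canonical__measure_function_Measure P mE) mV.
have m1E B : m1 B = P (E `&` [set w | B [tuple X i w | i < q]]).
  by rewrite /m1 /= /pushforward /mrestr setIC.
have [L hL] := @exists_tuple_measure R q.
pose p := fine (P E).
have pE : P E = p%:E by rewrite /p fineK// fin_num_measure.
have p0 : 0 <= p by rewrite fine_ge0.
pose h (v : q.-tuple R) := (p * \prod_(i < q) f i (tnth v i))%:E.
have mh : measurable_fun setT h.
  apply/measurable_EFinP; apply: measurable_funM => //.
  exact: measurable_prod_tnth.
have h0 v : (0 <= h v)%E.
  by rewrite lee_fin mulr_ge0//; apply: prodr_ge0 => i _.
have dE B : measurable B -> density_measure L h B =
    tuple_integral (fun v => (p * \prod_(i < q) f i (tnth v i) * \1_B v)%:E).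
  move=> mB; rewrite /density_measure integral_mkcond epatch_indic hL//.
    apply: emeasurable_funM => //.
    by apply/measurable_EFinP; exact: measurable_indic.
  by move=> v; rewrite mule_ge0// lee_fin.
rewrite -m1E -dE//.
apply: (@measure_tuple_unique _ _ m1 (measure_of_density L mh h0)) => //.
  rewrite m1E; apply: (@le_lt_trans _ _ 1%E); last exact: ltry.
  apply: probability_le1; apply: measurableI => //.
  by rewrite (_ : [set w | _] = setT)//; apply/seteqP.
move=> B mB; rewrite m1E /= dE; last exact: measurable_tuple_rect.
rewrite (_ : [set w | _] = [set w | forall i, B i (X i w)]); last first.
  apply/seteqP; split => w /= Hw i; have := Hw i; rewrite tnth_mktuple//.
rewrite ind// pE.
transitivity (tuple_integral (fun v : q.-tuple R =>
    p%:E * (\prod_(i < q) (f i (tnth v i) * \1_(B i) (tnth v i)))%:E))%E; last first.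
  congr tuple_integral; apply/funext => v; rewrite -EFinM -mulrA big_split /=.
  congr (_ * (_ * _))%:E.
  have [Bv|nBv] := pselect (tuple_rect B v).
    rewrite indicE mem_set// big1// => i _; rewrite indicE mem_set//; exact: Bv.
  rewrite indicE memNset//; have /existsNP[i nBi] := nBv.
  by rewrite (bigD1 i)//= indicE memNset// mul0r.
have mfB i : measurable_fun setT (fun x => f i x * \1_(B i) x).
  by apply: measurable_funM => //; exact: measurable_indic.
have fB0 i x : 0 <= f i x * \1_(B i) x by rewrite mulr_ge0.
rewrite tuple_integralZl//; last 2 first.
- by apply/measurable_EFinP; exact: (measurable_prod_tnth mfB).
- by move=> v; rewrite lee_fin; apply: prodr_ge0 => i _.
rewrite (tuple_integral_prod mfB fB0); congr (_ * _)%E.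
apply: eq_bigr => i _; rewrite fX// integral_mkcond epatch_indic.
by apply: eq_integral => x _.
Qed.

Definition gamma_density a s (x : R) : R :=
  a `^ s / Gamma s * x `^ (s - 1) * expR (- (a * x)) * \1_(`]0, +oo[%classic) x.

Lemma measurable_gamma_density a s : measurable_fun setT (gamma_density a s).
Proof.
apply: measurable_funM; last exact: measurable_indic.
apply: measurable_funM; last first.
  by apply: measurableT_comp => //; apply: measurableT_comp => //; exact: mulrl_measurable.
by apply: measurable_funM => //; exact: measurable_powR.
Qed.

Lemma gamma_density_ge0 a s x : 0 < s -> 0 <= gamma_density a s x.
Proof.
move=> s0; have G0 := Gamma_gt0 s0.
by rewrite !mulr_ge0 ?powR_ge0 ?expR_ge0// invr_ge0 ltW.
Qed.

Lemma gamma_density_factor a s n y : 0 < a -> 0 < s -> 0 < y ->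
  gamma_density a (n%:R + s) y = rGamma (n%:R + s) * density_factor a s n y.
Proof.
move=> a0 s0 y0; rewrite /gamma_density indicE mem_set ?mulr1; last first.
  by rewrite /= in_itv /= y0.
have ns0 : 0 < n%:R + s by rewrite ltr_wpDl.
rewrite rGammaV// /density_factor powRM ?(ltW a0) ?(ltW y0)// powRB1_gt0//.
by ring.
Qed.

(** The negative binomial weight is [Gamma(n + s) / (n! Gamma(s))] up to powers. It cancels one of
    the [q] factors [1/Gamma(n + s)] of the gamma densities, whence the exponent [q - 1] in the
    density. *)
Lemma gbinom_rGamma s n : 0 < s ->
  gbinom (n%:R + s - 1) n * rGamma (n%:R + s) = rGamma s / n`!%:R.
Proof.
move=> s0; rewrite (rGamma_natD s n) /gbinom (addrC s).
rewrite mulrAC; congr (_ * _ / _).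
rewrite [RHS](reindex_inj rev_ord_inj) /=; apply: eq_bigr => i _.
rewrite natrB// -natr1; ring.
Qed.

Lemma gamma_law_shift lambda t n : lambda != 0 ->
  lambda * (t + lambda^-1 * n%:R) = n%:R + lambda * t.
Proof. by move=> l0; rewrite mulrDr mulVKf// addrC. Qed.

Section processes.
Variables (q : nat) (lambda theta a : R) (Z : 'I_q -> R -> T -> R) (B : R -> T -> nat).
Hypotheses (hq : (0 < q)%N) (hlambda : 0 < lambda).
Hypotheses (htheta0 : 0 < theta) (htheta1 : theta < 1) (ha : 0 < a).
Hypothesis hZ : forall i, gamma_levy_process P lambda a (Z i).
Hypothesis hB : negbinom_levy_process P lambda theta B.
Hypothesis hindep : independent_processes P lambda Z B.

Let time t (n : nat) : R := t + lambda^-1 * n%:R.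

Let event t (n : nat) : set T := [set w | B (lambda * t) w = n].

Let time_ge0 t n : 0 <= t -> 0 <= time t n.
Proof. by move=> t0; rewrite addr_ge0// mulr_ge0// invr_ge0 ltW. Qed.

Let measurable_event t n : 0 <= t -> measurable (event t n).
Proof.
move=> t0; have -> : event t n = setT `&` B (lambda * t) @^-1` [set n].
  by rewrite setTI.
exact: (negbinom_measurable hB t0).
Qed.

Let measurable_Z i t n : 0 <= t -> measurable_fun setT (Z i (time t n)).
Proof. by move=> t0; apply: levy_measurable (gamma_levy (hZ i)) _ _; exact: time_ge0. Qed.

Let measurable_vector t n : 0 <= t ->
  measurable_fun setT (fun w => [tuple Z i (time t n) w | i < q]).
Proof.
move=> t0; apply/measurable_fun_tnthP => i.
rewrite (_ : _ \o _ = Z i (time t n)); first exact: measurable_Z.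
by apply/funext => w /=; rewrite tnth_mktuple.
Qed.

Lemma gamma_subordinator_preimage t (A : set (q.-tuple R)) :
  gamma_subordinator lambda Z B t @^-1` A =
  \bigcup_n (event t n `&` [set w | A [tuple Z i (time t n) w | i < q]]).
Proof.
apply/seteqP; split => [w Aw|w [n _ [/= <- Aw]]]; last exact: Aw.
by exists (B (lambda * t) w).
Qed.

Let measurable_piece t n (A : set (q.-tuple R)) : 0 <= t -> measurable A ->
  measurable (event t n `&` [set w | A [tuple Z i (time t n) w | i < q]]).
Proof.
move=> t0 mA; apply: measurableI; first exact: measurable_event.
by have := measurable_vector n t0 measurableT mA; rewrite setTI.
Qed.

Lemma measurable_gamma_subordinator t (A : set (q.-tuple R)) : 0 <= t -> measurable A ->
  measurable (gamma_subordinator lambda Z B t @^-1` A).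
Proof.
move=> t0 mA; rewrite gamma_subordinator_preimage.
by apply: bigcup_measurable => n _; exact: measurable_piece.
Qed.

(** On this event the random time is the constant [t + n / lambda], at which every [Z i] has shape
    [n + lambda * t]; independence of the [Z i] and [B] does the rest. *)
Lemma gamma_subordinator_law_given t n (A : set (q.-tuple R)) : 0 < t -> measurable A ->
  P (event t n `&` [set w | A [tuple Z i (time t n) w | i < q]]) =
  tuple_integral (fun v =>
    (fine (P (event t n)) * \prod_(i < q) gamma_density a (n%:R + lambda * t) (tnth v i)
     * \1_A v)%:E).
Proof.
move=> t0 mA.
have l0 : lambda != 0 by rewrite gt_eqF.
have s0 : 0 < n%:R + lambda * t by rewrite ltr_wpDl// mulr_gt0.
have tn0 : 0 < time t n by rewrite ltr_wpDr// mulr_ge0// invr_ge0 ltW.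
apply: (@independent_density_law q (fun i => Z i (time t n))
  (fun i => gamma_density a (n%:R + lambda * t))) => //.
- by apply: measurable_event; exact: ltW.
- by move=> i; apply: measurable_Z; exact: ltW.
- by move=> i; exact: measurable_gamma_density.
- by move=> i x; exact: gamma_density_ge0.
- move=> i C mC; rewrite (gamma_law (hZ i) tn0 mC) /time gamma_law_shift//.
  rewrite integral_mkcondr; apply: eq_integral => x _.
  by rewrite epatch_indic /= -EFinM.
- move=> C mC.
  pose F (o : option 'I_q) := if o is Some i then Z i (time t n) @^-1` C i else event t n.
  have := hindep (E := F); rewrite prode_option /= => <-.
    congr (P _); apply/seteqP; split => [w [Ew Cw]|w h].
      by case=> [i|] _; [exact: Cw|exact: Ew].
    by split => [|i]; [exact: (h None I)|exact: (h (Some i) I)].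
  case=> [i|] /=; apply: sub_sigma_algebra.
    exists (time t n); first exact: ltW.
    by exists (C i) => //; rewrite setTI.
  exists t; first exact: ltW.
  by exists [set n] => //; rewrite setTI.
Qed.

Lemma event_prob t n : 0 <= t -> P (event t n) =
  ((1 - theta) `^ (lambda * t) * gbinom (n%:R + lambda * t - 1) n * theta ^+ n)%:E.
Proof. by move=> t0; exact: (negbinom_law hB t0). Qed.

Lemma gamma_subordinator_has_density t : 0 < t ->
  has_orthant_density P (gamma_subordinator lambda Z B t)
    (fun x => gamma_subordinator_density lambda theta (fun=> a) x t).
Proof.
move=> t0 A mA; have t0' := ltW t0.
have s0 : 0 < lambda * t by rewrite mulr_gt0.
rewrite gamma_subordinator_preimage measure_semi_bigcup; first last.
- by rewrite -gamma_subordinator_preimage; exact: measurable_gamma_subordinator.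
- apply/trivIsetP => i j _ _ ij; apply/seteqP; split => // w [[/= e1 _] [/= e2 _]].
  by move: ij; rewrite -e1 -e2 eqxx.
- by move=> n; exact: measurable_piece.
rewrite (eq_eseriesr (fun n _ => gamma_subordinator_law_given n t0 mA)).
rewrite -tuple_integral_nneseries; first last.
- move=> n v; rewrite lee_fin !mulr_ge0//.
    (* The weight is nonnegative because it is a probability, without inspecting the generalised
       binomial. *)
    by rewrite event_prob//= -lee_fin -event_prob.
  apply: prodr_ge0 => i _; apply: gamma_density_ge0.
  by rewrite ltr_wpDl.
- move=> n; apply/measurable_EFinP; apply: measurable_funM; last exact: measurable_indic.
  apply: measurable_funM => //.
  apply: (measurable_prod_tnth (f := fun=> gamma_density a (n%:R + lambda * t))) => i.
  exact: measurable_gamma_density.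
congr tuple_integral; apply/funext => v.
have [Av|nAv] := pselect (A v); last first.
  rewrite eseries0 => [|n _ _]; last by rewrite indicE memNset// mulr0.
  by rewrite indicE memNset ?mulr0// => -[].
have [v0|nv0] := pselect (forall i, 0 < tnth v i); last first.
  have /existsNP[i nvi] := nv0.
  have n0 : ~ (A `&` [set w : q.-tuple R | forall j, 0 < tnth w j]) v.
    by case=> _ /(_ i).
  rewrite eseries0 => [|n _ _]; first by rewrite indicE (memNset n0) mulr0.
  have z s : gamma_density a s (tnth v i) = 0.
    rewrite /gamma_density indicE memNset ?mulr0//.
    by rewrite /= in_itv /= andbT.
  by rewrite (bigD1 i)//= z !(mul0r, mulr0).
set x := (\row_i tnth v i : 'rV[R]_q).
have ox : orthant q x by move=> i; rewrite mxE.
rewrite !indicE !mem_set// mulr1.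
set K0 := (1 - theta) `^ (lambda * t) * rGamma (lambda * t).
have E n : fine (P (event t n)) *
    \prod_(i < q) gamma_density a (n%:R + lambda * t) (tnth v i) * 1 =
    K0 * (density_coef q theta (lambda * t) n * partial_term a (lambda * t) [::] x n).
  rewrite mulr1 event_prob//= partial_term_nil.
  have -> : \prod_(i < q) gamma_density a (n%:R + lambda * t) (tnth v i) =
      rGamma (n%:R + lambda * t) ^+ q *
      \prod_(i < q) density_factor a (lambda * t) n (x ord0 i).
    have C (y : R) : \prod_(i < q) y = y ^+ q by rewrite prodr_const card_ord.
    rewrite -C -big_split /=; apply: eq_bigr => i _.
    by rewrite mxE gamma_density_factor.
  have G := gbinom_rGamma n s0.
  rewrite /K0 /density_coef.
  have -> : rGamma (n%:R + lambda * t) ^+ q =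
     rGamma (n%:R + lambda * t) * rGamma (n%:R + lambda * t) ^+ (q - 1).
    by case: (q) hq => // p _; rewrite subn1 exprS.
  move: G; move: (gbinom _ _) (rGamma (n%:R + lambda * t)) (rGamma (lambda * t)).
  move=> b u u0 G; move: (u ^+ (q - 1)) (theta ^+ n) (\prod_(i < q) _) => U th D.
  transitivity ((1 - theta) `^ (lambda * t) * th * U * D * (b * u)); first by ring.
  by rewrite G; ring.
rewrite (eq_eseriesr (g := fun n => (K0 * (density_coef q theta (lambda * t) n *
   partial_term a (lambda * t) [::] x n))%:E)); last by move=> n _; rewrite E.
have cv := entire_coef_cvg1 (entire_coef_partial_term theta (lambda * t) [::] ha ox).
rewrite gamma_subordinator_densityE -/K0.
apply/cvg_lim => //.
have -> : (fun n => \sum_(0 <= i < n) (K0 * (density_coef q theta (lambda * t) i *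
   partial_term a (lambda * t) [::] x i))%:E)%E =
  EFin \o (fun n => K0 * series (fun n => density_coef q theta (lambda * t) n *
   partial_term a (lambda * t) [::] x n) n).
  by apply/funext => n /=; rewrite sumEFin /series /= mulr_sumr.
apply: cvg_EFin; first exact: nearW.
by apply: cvgM; [exact: cvg_cst|exact: cv].
Qed.

(** At time 0 the count is 0 with probability 1, its weight being [(1 - theta) ^ 0 = 1], and each
    [Z i] starts at 0 almost surely. A set containing the origin is handled through its complement,
    which is null. *)
Lemma gamma_subordinator_law0 (A : set (q.-tuple R)) : measurable A ->
  P (gamma_subordinator lambda Z B 0 @^-1` A) =
  @dirac _ (q.-tuple R) [tuple 0 | i < q] R A.
Proof.
pose o : q.-tuple R := [tuple 0 | i < q].
have ae0 : {ae P, forall w, gamma_subordinator lambda Z B 0 w = o}.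
  have aeB : {ae P, forall w, B (lambda * 0) w = 0%N}.
    exists (~` event 0 0); split => //.
      by apply: measurableC; exact: measurable_event.
    rewrite probability_setC; last exact: measurable_event.
    rewrite event_prob// mulr0 powRr0 /gbinom big_ord0 fact0 divr1 expr0 !mulr1.
    by rewrite subee.
  have aeZ : {ae P, forall w, forall i, Z i 0 w = 0}.
    apply: filter_forall => i; exact: (levy_start (gamma_levy (hZ i))).
  apply: filterS2 aeB aeZ => w Bw Zw; apply: eq_from_tnth => i.
  by rewrite !tnth_mktuple Bw mulr0 addr0 Zw.
have null (C : set (q.-tuple R)) : measurable C -> ~ C o ->
    P (gamma_subordinator lambda Z B 0 @^-1` C) = 0.
  move=> mC nC; apply: measure_negligible.
    exact: measurable_gamma_subordinator.
  by apply: negligibleS ae0 => w /= Cw e; apply: nC; rewrite -e.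
move=> mA; rewrite diracE; have [Ao|nAo] := pselect (A o); last first.
  by rewrite memNset// null.
have -> : gamma_subordinator lambda Z B 0 @^-1` A =
    ~` (gamma_subordinator lambda Z B 0 @^-1` (~` A)) by rewrite preimage_setC setCK.
rewrite mem_set// probability_setC.
  rewrite null; [by rewrite sube0|exact: measurableC|by []].
by apply: measurable_gamma_subordinator => //; exact: measurableC.
Qed.

End processes.
End gamma_subordinator_law.

Theorem theorem3p1 (R : realType) (d : measure_display) (T : measurableType d)
    (P : probability T R) (q : nat) (lambda theta a : R)
    (Z : 'I_q -> R -> T -> R) (B : R -> T -> nat)
    (hq : (0 < q)%N) (hlambda : 0 < lambda)
    (htheta0 : 0 < theta) (htheta1 : theta < 1) (ha : 0 < a)
    (hZ : forall i, gamma_levy_process P lambda a (Z i))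
    (hB : negbinom_levy_process P lambda theta B)
    (hindep : independent_processes P lambda Z B) :
  let G := gamma_subordinator lambda Z B in
  let g : 'rV[R]_q -> R -> R :=
    gamma_subordinator_density lambda theta (fun=> a) in
  [/\ forall t, 0 < t -> has_orthant_density P (G t) (fun x => g x t),
      forall (x : 'rV[R]_q) (t : R), orthant q x -> 0 <= t ->
        [/\ forall J : {set 'I_q},
              mixed_partial_exists (orthant q) (enum J) (fun y => g y t),
            shift_well_defined lambda^-1 (g x) t &
            gamma_operator a (fun y => g y t) x =
            - (1 - theta) * a ^+ q * (g x t - shift_operator lambda^-1 (g x) t)],
      forall A : set (q.-tuple R), measurable A ->
        P (G 0 @^-1` A) = @dirac _ (q.-tuple R) [tuple 0 | i < q] R A &
      forall t, 0 <= t ->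
        (forall e, 0 < e ->
           vanishes_at_infinity (inner_orthant q e) (fun x => g x t)) /\
        (t = 0 \/ 1 <= lambda * t ->
           vanishes_at_infinity (orthant q) (fun x => g x t))].
Proof.
move=> G g.
have l0 : lambda != 0 by rewrite gt_eqF.
have t01 : 0 < theta < 1 by rewrite htheta0.
split.
- by move=> t t0; exact: gamma_subordinator_has_density.
- move=> x t ox t0.
  have [N hN] := gamma_subordinator_density_entire lambda htheta1 ha ox.
  have sh := entire_bound_shift lambda^-1 t hN.
  split => //.
    move=> J; apply: (mixed_partial_density ha (enum_uniq J) _).1 => y oy.
    exact: gamma_subordinator_densityE.
  rewrite /shift_operator (cvg_lim _ sh.2)//.
  exact: gamma_subordinator_density_pde.
- by move=> A mA; exact: (gamma_subordinator_law0 hlambda hZ hB mA).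
- move=> t t0; split=> [e e0|h].
    apply: gamma_subordinator_density_vanishes => //; last by constructor 3; exists e.
    by move=> x hx i; exact: lt_le_trans (hx i).
  apply: gamma_subordinator_density_vanishes => //.
  by case: h => [->|h]; [constructor 1|constructor 2].
Qed.
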